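(* For every integer $n\ge0$, the strict $\infty$-groupoid $\widetilde D_n=L(D_n)$, the free strict $\infty$-groupoid on the $n$-disk $D_n$, is weakly contractible.
   Context: Globe category. $\mathbb{G}$ has objects $D_0,D_1,\dots$ and is generated by $\sigma_i,\tau_i:D_{i-1}\to D_i$ ($i\ge1$) subject to $\sigma_{i+1}\sigma_i=\tau_{i+1}\sigma_i$ and $\sigma_{i+1}\tau_i=\tau_{i+1}\tau_i$. A globular set is a presheaf on $\mathbb{G}$; the $n$-disk is the representable globular set $D_n$. Strict $\infty$-groupoids. A strict $\infty$-category is a globular set $G$ (sets $G_i$ of $i$-arrows, source and target maps $s_i,t_i:G_i\to G_{i-1}$, iterated to $s^i_j,t^i_j:G_i\to G_j$) with compositions $u\ast^i_j v$ for $i$-arrows with $s^i_j(u)=t^i_j(v)$, $i>j\ge0$, and identities $k_i:G_i\to G_{i+1}$, satisfying the usual source/target, associativity, exchange, identity and functoriality-of-identities axioms. It is a strict $\infty$-groupoid if every $i$-arrow $u:x\to y$, $i\ge1$, has a $\ast^i_{i-1}$-inverse. Morphisms are the maps of globular sets preserving compositions and identities. $L$ denotes the left adjoint of the forgetful functor from strict $\infty$-groupoids to globular sets. Weak contractibility. In a strict $\infty$-groupoid $G$, write $u\sim v$ for $n$-arrows $u,v$ if there is an $(n+1)$-arrow from $u$ to $v$; this is an equivalence relation. Put $\pi_0(G)=G_0/{\sim}$ and, for $m\ge1$ and $x\in G_0$, let $\pi_m(G,x)$ be the group (under $\ast^m_{m-1}$) of $m$-arrows from $k^{m-1}_0(x)$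 to itself modulo $\sim$, where $k^{m-1}_0(x)$ is the $(m-1)$-dimensional iterated identity of $x$. $G$ is weakly contractible if $\pi_0(G)$ is a one-element set and $\pi_m(G,x)$ is trivial for all $m\ge1$ and all objects $x$. *)

(* Defs.v *)
From HB Require Import structures.
From mathcomp Require Import all_boot.
From mathcomp Require Import boolp.

Set Implicit Arguments.
Unset Strict Implicit.
Unset Printing Implicit Defensive.

Local Open Scope quotient_scope.

(** * Globular sets *)

(* A presheaf on the globe category, written out on the generators: [src] and
   [tgt] are the actions of sigma_{i+1} and tau_{i+1}. *)
Record globular_set := GlobularSet {
  cell :> nat -> Type;
  src : forall i, cell i.+1 -> cell i;
  tgt : forall i, cell i.+1 -> cell i;
  src_tgt : forall i (u : cell i.+2), src (src u) = src (tgt u);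
  tgt_src : forall i (u : cell i.+2), tgt (src u) = tgt (tgt u)
}.

Arguments src {g i}.
Arguments tgt {g i}.

Record globular_map (X Y : globular_set) := GlobularMap {
  gmap :> forall i, X i -> Y i;
  gmap_src : forall i (u : X i.+1), gmap (src u) = src (gmap u);
  gmap_tgt : forall i (u : X i.+1), gmap (tgt u) = tgt (gmap u)
}.

Arguments gmap {X Y} g i.

(* Morphisms D_i -> D_n of the globe category, by generators and relations.
   A word is a composite of generators; [gpre e w] is w precomposed with
   sigma_{i+1} (if e = false) or tau_{i+1} (if e = true), D_i -> D_{i+1}. *)
Inductive gword (n : nat) : nat -> Type :=
| gnil : gword n n
| gpre (e : bool) i : gword n i.+1 -> gword n i.

(* The congruence generated by the coglobular relations. *)
Inductive gword_eq (n : nat) : forall i, gword n i -> gword n i -> Prop :=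
| gword_refl i (w : gword n i) : gword_eq w w
| gword_sym i (w w' : gword n i) : gword_eq w w' -> gword_eq w' w
| gword_trans i (w1 w2 w3 : gword n i) :
    gword_eq w1 w2 -> gword_eq w2 w3 -> gword_eq w1 w3
| gword_pre e i (w w' : gword n i.+1) :
    gword_eq w w' -> gword_eq (gpre e w) (gpre e w')
| gword_rel e i (w : gword n i.+2) :
    gword_eq (gpre e (gpre false w)) (gpre e (gpre true w)).

Section GlobeHom.
Variables n i : nat.

Definition gword_eqb : rel {classic (gword n i)} := fun w w' => `[< gword_eq w w' >].

Lemma gword_eqb_equiv : equiv_class_of gword_eqb.
Proof.
split=> [w|w w'|w2 w1 w3].
- exact/asboolP/gword_refl.
- by apply/asboolP/asboolP => /gword_sym.
- by move=> /asboolP h1 /asboolP h2; apply/asboolP/(gword_trans h1 h2).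
Qed.

Canonical gword_equiv_rel := EquivRelPack gword_eqb_equiv.

Definition globe_hom := {eq_quot gword_eqb}.

Definition gclass (w : gword n i) : globe_hom := \pi_globe_hom (w : {classic _}).

Lemma gclassP (w w' : gword n i) : gclass w = gclass w' <-> gword_eq w w'.
Proof. by split=> [/eqmodP/asboolP|h] //; apply/eqmodP/asboolP. Qed.

Lemma gclass_surj (c : globe_hom) : exists w, c = gclass w.
Proof. by exists (repr c); rewrite /gclass reprK. Qed.

End GlobeHom.

Definition globe_pre n (e : bool) i (c : globe_hom n i.+1) : globe_hom n i :=
  gclass (gpre e (repr c : gword n i.+1)).

Lemma globe_pre_class n e i (w : gword n i.+1) :
  globe_pre e (gclass w) = gclass (gpre e w).
Proof. by apply/gclassP/gword_pre/gclassP; rewrite [LHS]reprK. Qed.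

Lemma globe_pre_rel n e i (c : globe_hom n i.+2) :
  globe_pre e (globe_pre false c) = globe_pre e (globe_pre true c).
Proof.
have [w ->] := gclass_surj c; rewrite !globe_pre_class.
exact/gclassP/gword_rel.
Qed.

(* The representable globular set Hom(-, D_n). *)
Definition disk (n : nat) : globular_set :=
  {| cell := globe_hom n;
     src := @globe_pre n false;
     tgt := @globe_pre n true;
     src_tgt := @globe_pre_rel n false;
     tgt_src := @globe_pre_rel n true |}.

(** * Strict infinity-groupoids *)

(* A Type-valued version of j <= i, which lets the iterated maps between
   dimensions i and j be defined without transport along equalities on nat.
   It has exactly one inhabitant if j <= i and none otherwise. *)
Inductive upto (j : nat) : nat -> Set :=
| upto_refl : upto j j
| upto_S i : upto j i -> upto j i.+1.

Arguments upto_refl {j}.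

Fixpoint upto0 i : upto 0 i := if i is i'.+1 then upto_S (upto0 i') else upto_refl.

Fixpoint isrc (G : globular_set) j i (p : upto j i) : G i -> G j :=
  match p in upto _ i return G i -> G j with
  | upto_refl => id
  | upto_S _ p => fun u => isrc p (src u)
  end.

Fixpoint itgt (G : globular_set) j i (p : upto j i) : G i -> G j :=
  match p in upto _ i return G i -> G j with
  | upto_refl => id
  | upto_S _ p => fun u => itgt p (tgt u)
  end.

Fixpoint iunit (G : globular_set) (k : forall i, G i -> G i.+1)
    j i (p : upto j i) : G j -> G i :=
  match p in upto _ i return G j -> G i with
  | upto_refl => id
  | upto_S _ p => fun x => k _ (iunit k p x)
  end.

(* For p : upto j i, [composable p u v] says that s^{i+1}_j(u) = t^{i+1}_j(v);
   note that the ambient dimension is i.+1, so that j < i.+1. *)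
Definition composable (G : globular_set) j i (p : upto j i) (u v : G i.+1) :=
  isrc (upto_S p) u = itgt (upto_S p) v.

(* For p : upto j i, [comp p u v _] is u *^{i+1}_j v.  The axioms quantify over
   all composability proofs making both sides meaningful, including those
   that could be derived from the other ones: for instance H' in [src_comp] follows from H
   by the globular relations. *)
Record strict_category := StrictCategory {
  glob :> globular_set;
  unit_cell : forall i, glob i -> glob i.+1;
  comp : forall j i (p : upto j i) (u v : glob i.+1),
    composable p u v -> glob i.+1;
  src_unit : forall i (u : glob i), src (unit_cell u) = u;
  tgt_unit : forall i (u : glob i), tgt (unit_cell u) = u;
  src_comp_top : forall i (u v : glob i.+1) (H : composable upto_refl u v),
    src (comp H) = src v;
  tgt_comp_top : forall i (u v : glob i.+1) (H : composable upto_refl u v),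
    tgt (comp H) = tgt u;
  src_comp : forall j i (p : upto j i) (u v : glob i.+2)
      (H : composable (upto_S p) u v) (H' : composable p (src u) (src v)),
    src (comp H) = comp H';
  tgt_comp : forall j i (p : upto j i) (u v : glob i.+2)
      (H : composable (upto_S p) u v) (H' : composable p (tgt u) (tgt v)),
    tgt (comp H) = comp H';
  comp_assoc : forall j i (p : upto j i) (u v w : glob i.+1)
      (Huv : composable p u v) (Hvw : composable p v w)
      (Huv_w : composable p (comp Huv) w) (Hu_vw : composable p u (comp Hvw)),
    comp Huv_w = comp Hu_vw;
  (* (u *_k u') *_j (v *_k v') = (u *_j v) *_k (u' *_j v') *)
  exchange : forall j k i (p : upto j i) (q : upto k i) (u u' v v' : glob i.+1)
      (Hu : composable q u u') (Hv : composable q v v')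
      (H : composable p u v) (H' : composable p u' v')
      (Hl : composable p (comp Hu) (comp Hv))
      (Hr : composable q (comp H) (comp H')),
    j < k -> comp Hl = comp Hr;
  comp_unit_l : forall j i (p : upto j i) (u : glob i.+1)
      (H : composable p (iunit unit_cell (upto_S p) (itgt (upto_S p) u)) u),
    comp H = u;
  comp_unit_r : forall j i (p : upto j i) (u : glob i.+1)
      (H : composable p u (iunit unit_cell (upto_S p) (isrc (upto_S p) u))),
    comp H = u;
  unit_comp : forall j i (p : upto j i) (u v : glob i.+1)
      (H : composable p u v)
      (H' : composable (upto_S p) (unit_cell u) (unit_cell v)),
    unit_cell (comp H) = comp H'
}.

Arguments unit_cell {s i}.
Arguments comp {s j i} p {u v}.

Definition iid (G : strict_category) j i (p : upto j i) : G j -> G i :=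
  iunit (@unit_cell G) p.

(* [v] is an inverse of the (i+1)-arrow [u] for *^{i+1}_i. *)
Definition is_inverse (G : strict_category) i (u v : G i.+1) :=
  exists (Huv : composable upto_refl u v) (Hvu : composable upto_refl v u),
    comp upto_refl Huv = unit_cell (tgt u) /\
    comp upto_refl Hvu = unit_cell (src u).

Record strict_groupoid := StrictGroupoid {
  scat :> strict_category;
  has_inverse : forall i (u : scat i.+1), exists v, is_inverse u v
}.

Record strict_functor (G H : strict_category) := StrictFunctor {
  fmap :> globular_map G H;
  fmap_unit : forall i (u : G i), fmap i.+1 (unit_cell u) = unit_cell (fmap i u);
  fmap_comp : forall j i (p : upto j i) (u v : G i.+1)
      (E : composable p u v) (E' : composable p (fmap i.+1 u) (fmap i.+1 v)),
    fmap i.+1 (comp p E) = comp p E'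
}.

Section CompositionLemmas.
Variable G : strict_category.

Lemma comp_congr j i (p : upto j i) (u u' v v' : G i.+1)
    (H : composable p u v) (H' : composable p u' v') :
  u = u' -> v = v' -> comp p H = comp p H'.
Proof.
by move=> eu ev; move: H H'; rewrite eu ev => H H'; rewrite (Prop_irrelevance H H').
Qed.

Lemma comp_top_unit_l i (u : G i.+1)
    (H : composable upto_refl (unit_cell (tgt u)) u) : comp upto_refl H = u.
Proof. exact: (@comp_unit_l G i i upto_refl). Qed.

Lemma comp_top_unit_r i (u : G i.+1)
    (H : composable upto_refl u (unit_cell (src u))) : comp upto_refl H = u.
Proof. exact: (@comp_unit_r G i i upto_refl). Qed.

Lemma is_inverse_sym i (u v : G i.+1) : is_inverse u v -> is_inverse v u.
Proof.
move=> [Huv [Hvu [e1 e2]]]; exists Hvu, Huv; split.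
- by rewrite e2 (Huv : src u = tgt v).
- by rewrite e1 (Hvu : src v = tgt u).
Qed.

Lemma is_inverse_uniq i (u v v' : G i.+1) :
  is_inverse u v -> is_inverse u v' -> v = v'.
Proof.
move=> [Huv [Hvu [e1 e2]]] [Huv' [Hvu' [e1' e2']]].
have sv : src v = tgt u by exact: Hvu.
have tv' : tgt v' = src u by rewrite (Huv' : src u = tgt v').
have Hl : composable upto_refl v (comp upto_refl Huv').
  by rewrite /composable /= tgt_comp_top.
have Hr : composable upto_refl (comp upto_refl Hvu) v'.
  by rewrite /composable /= src_comp_top tv'.
have := comp_assoc Hr Hl.
have K1 : composable upto_refl v (unit_cell (src v)) by rewrite /composable /= tgt_unit.
have K2 : composable upto_refl (unit_cell (tgt v')) v' by rewrite /composable /= src_unit.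
rewrite (@comp_congr _ _ _ _ _ _ _ Hl K1) ?comp_top_unit_r ?e1' ?sv //.
by rewrite (@comp_congr _ _ _ _ _ _ _ Hr K2) ?comp_top_unit_l ?e2 ?tv' //.
Qed.

End CompositionLemmas.

(** * Homotopy groups *)

Definition homotopic (G : globular_set) i (u v : G i) :=
  exists a : G i.+1, src a = u /\ tgt a = v.

Section Homotopy.
Variable G : strict_groupoid.

Lemma homotopic_refl i (u : G i) : homotopic u u.
Proof. by exists (unit_cell u); rewrite src_unit tgt_unit. Qed.

Lemma homotopic_sym i (u v : G i) : homotopic u v -> homotopic v u.
Proof.
move=> [a [<- <-]]; have [b [Hab [Hba _]]] := has_inverse a.
by exists b; split; [exact: Hba | exact: (esym Hab)].
Qed.

Lemma homotopic_trans i (u v w : G i) :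
  homotopic u v -> homotopic v w -> homotopic u w.
Proof.
move=> [a [<- ta]] [b [sb <-]].
have H : composable upto_refl b a by rewrite /composable /= sb.
by exists (comp upto_refl H); rewrite src_comp_top tgt_comp_top.
Qed.

Definition object_eqb : rel {classic (G 0)} := fun x y => `[< homotopic x y >].

Lemma object_eqb_equiv : equiv_class_of object_eqb.
Proof.
split=> [u|u v|v u w].
- exact/asboolP/homotopic_refl.
- by apply/asboolP/asboolP => /homotopic_sym.
- by move=> /asboolP h1 /asboolP h2; apply/asboolP/(homotopic_trans h1 h2).
Qed.

Canonical object_equiv_rel := EquivRelPack object_eqb_equiv.

Definition pi0 := {eq_quot object_eqb}.

Section Pi.
Variables (m : nat) (x : G 0).

(* The (m+1)-arrows from k^m_0(x) to itself. *)
Record loop := Loop {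
  loop_cell :> G m.+1;
  loop_src : src loop_cell = iid (upto0 m) x;
  loop_tgt : tgt loop_cell = iid (upto0 m) x
}.

Lemma loop_eq (u v : loop) : u = v :> G m.+1 -> u = v.
Proof.
case: u v => [u su tu] [v sv tv] /= e; move: sv tv; rewrite -e => sv tv.
by rewrite (Prop_irrelevance sv su) (Prop_irrelevance tv tu).
Qed.

Definition loop_eqb : rel {classic loop} :=
  fun u v => `[< homotopic (u : loop) (v : loop) >].

Lemma loop_eqb_equiv : equiv_class_of loop_eqb.
Proof.
split=> [u|u v|v u w].
- exact/asboolP/homotopic_refl.
- by apply/asboolP/asboolP => /homotopic_sym.
- by move=> /asboolP h1 /asboolP h2; apply/asboolP/(homotopic_trans h1 h2).
Qed.

Canonical loop_equiv_rel := EquivRelPack loop_eqb_equiv.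

(* pi_{m+1}(G, x) *)
Definition pi := {eq_quot loop_eqb}.

Definition pi_class (u : loop) : pi := \pi_pi (u : {classic loop}).

Lemma pi_classP (u v : loop) : pi_class u = pi_class v <-> homotopic u v.
Proof. by split=> [/eqmodP/asboolP|h] //; apply/eqmodP/asboolP. Qed.

Definition pi_repr (a : pi) : loop := repr a.

Lemma pi_reprK : cancel pi_repr pi_class.
Proof. by move=> a; rewrite /pi_class /pi_repr reprK. Qed.

Lemma loop_composable (u v : loop) : composable upto_refl u v.
Proof. by rewrite /composable /= loop_src loop_tgt. Qed.

Definition loop_mul (u v : loop) : loop :=
  Loop (etrans (src_comp_top (loop_composable u v)) (loop_src v))
       (etrans (tgt_comp_top (loop_composable u v)) (loop_tgt u)).

Definition loop_one : loop :=
  Loop (src_unit (iid (upto0 m) x)) (tgt_unit (iid (upto0 m) x)).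

Lemma loop_inv_subproof (u : loop) : exists v : loop, is_inverse u v.
Proof.
have [v Iuv] := has_inverse u; have [Huv [Hvu _]] := Iuv.
have sv : src v = iid (upto0 m) x by rewrite -(loop_tgt u).
have tv : tgt v = iid (upto0 m) x by rewrite -(loop_src u).
by exists (Loop sv tv).
Qed.

Definition loop_inv (u : loop) : loop := projT1 (cid (loop_inv_subproof u)).

Lemma loop_invP (u : loop) : is_inverse u (loop_inv u).
Proof. exact: projT2 (cid (loop_inv_subproof u)). Qed.

Definition pi_mul (a b : pi) : pi := pi_class (loop_mul (pi_repr a) (pi_repr b)).
Definition pi_one : pi := pi_class loop_one.
Definition pi_inv (a : pi) : pi := pi_class (loop_inv (pi_repr a)).

Lemma pi_mul_class (u v : loop) : pi_mul (pi_class u) (pi_class v) = pi_class (loop_mul u v).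
Proof.
apply/pi_classP.
have /pi_classP[a [sa ta]] := pi_reprK (pi_class u).
have /pi_classP[b [sb tb]] := pi_reprK (pi_class v).
have H : composable (upto_S upto_refl) a b.
  by rewrite /composable /= sa tb loop_src loop_tgt.
have Hs : composable upto_refl (src a) (src b) by rewrite sa sb; exact: loop_composable.
have Ht : composable upto_refl (tgt a) (tgt b) by rewrite ta tb; exact: loop_composable.
exists (comp _ H); split.
- by rewrite (src_comp H Hs); apply: comp_congr.
- by rewrite (tgt_comp H Ht); apply: comp_congr.
Qed.

Lemma pi_mulA : associative pi_mul.
Proof.
move=> a b c; rewrite -(pi_reprK a) -(pi_reprK b) -(pi_reprK c) !pi_mul_class.
by congr pi_class; apply: loop_eq => /=; rewrite -(comp_assoc (loop_composable (loop_mul _ _) _)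
  (loop_composable _ (loop_mul _ _))).
Qed.

Lemma pi_mul1 : left_id pi_one pi_mul.
Proof.
move=> a; rewrite -(pi_reprK a) pi_mul_class.
congr pi_class; apply: loop_eq => /=; set u := pi_repr a.
have H : composable upto_refl (unit_cell (tgt u)) u by rewrite /composable /= src_unit.
by rewrite -[RHS](comp_top_unit_l H); apply: comp_congr; rewrite // loop_tgt.
Qed.

Lemma pi_mulr1 : right_id pi_one pi_mul.
Proof.
move=> a; rewrite -(pi_reprK a) pi_mul_class.
congr pi_class; apply: loop_eq => /=; set u := pi_repr a.
have H : composable upto_refl u (unit_cell (src u)) by rewrite /composable /= tgt_unit.
by rewrite -[RHS](comp_top_unit_r H); apply: comp_congr; rewrite // loop_src.
Qed.

Lemma pi_mulV : left_inverse pi_one pi_inv pi_mul.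
Proof.
move=> a; rewrite -{2}(pi_reprK a) pi_mul_class; congr pi_class; apply: loop_eq => /=.
have [H1 [H2 [_ e]]] := loop_invP (pi_repr a).
by rewrite (@comp_congr _ _ _ _ _ _ _ _ _ H2) // e loop_src.
Qed.

Lemma pi_mulVr : right_inverse pi_one pi_inv pi_mul.
Proof.
move=> a; rewrite -{1}(pi_reprK a) pi_mul_class; congr pi_class; apply: loop_eq => /=.
have [H1 [H2 [e _]]] := loop_invP (pi_repr a).
by rewrite (@comp_congr _ _ _ _ _ _ _ _ _ H1) // e loop_tgt.
Qed.

HB.instance Definition _ := Choice.on pi.
HB.instance Definition _ :=
  isGroup.Build pi pi_mulA pi_mul1 pi_mulr1 pi_mulV pi_mulVr.

End Pi.
End Homotopy.

(* As [pi G m x] is pi_{m+1}(G, x), the second clause covers pi_m for all m >= 1. *)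
Definition weakly_contractible (G : strict_groupoid) :=
  (exists c : pi0 G, forall d : pi0 G, d = c) /\
  (forall (m : nat) (x : G 0) (a : pi m x), a = 1%g).

(** * Free strict infinity-groupoids *)

Arguments fmap {G H} s.

(* A left adjoint of the forgetful functor from strict infinity-groupoids to
   globular sets, given by universal arrows X -> U(L X). *)
Record left_adjoint := LeftAdjoint {
  ladj :> globular_set -> strict_groupoid;
  ladj_unit : forall X, globular_map X (ladj X);
  ladj_universal : forall (X : globular_set) (H : strict_groupoid)
      (g : globular_map X H),
    exists f : strict_functor (ladj X) H,
      (forall i (x : X i), fmap f i (ladj_unit X i x) = g i x) /\
      forall f' : strict_functor (ladj X) H,
        (forall i (x : X i), fmap f' i (ladj_unit X i x) = g i x) ->
        forall i (u : ladj X i), fmap f' i u = fmap f i u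
}.

(* Existence of the left adjoint.  Cells of the free groupoid are formal
   expressions that have a value under every map from X to a strict
   infinity-groupoid, identified when all their values agree. *)
Section Free.
Variable X : globular_set.

Inductive term : nat -> Type :=
| tgen i : X i -> term i
| tunit i : term i -> term i.+1
| tcomp j i : upto j i -> term i.+1 -> term i.+1 -> term i.+1
| tinv i : term i.+1 -> term i.+1.

Fixpoint ev (H : strict_groupoid) (g : globular_map X H) i (t : term i) : H i -> Prop :=
  match t in term i return H i -> Prop with
  | tgen i x => fun a => a = g i x
  | tunit i t => fun a => exists b, ev g t b /\ a = unit_cell b
  | tcomp j i p t t' => fun a => exists b c,
      ev g t b /\ ev g t' c /\ exists E : composable p b c, a = comp p E
  | tinv i t => fun a => exists b, ev g t b /\ is_inverse b a
  end.

Lemma ev_fun (H : strict_groupoid) (g : globular_map X H) i (t : term i) a b :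
  ev g t a -> ev g t b -> a = b.
Proof.
elim: t a b => {i} [i x|i t IH|j i p t IH t' IH'|i t IH] a b /=.
- by move=> -> ->.
- by move=> [c [tc ->]] [d [td ->]]; rewrite (IH _ _ tc td).
- move=> [c [d [tc [td [E ->]]]]] [c' [d' [tc' [td' [E' ->]]]]].
  by apply: comp_congr; [exact: IH tc tc' | exact: IH' td td'].
- move=> [c [tc ca]] [d [td db]]; move: db; rewrite -(IH _ _ tc td).
  exact: is_inverse_uniq ca.
Qed.

Definition bd (G : globular_set) (e : bool) i : G i -> G i.-1 :=
  match i return G i -> G i.-1 with
  | 0 => id
  | i.+1 => fun u => if e then tgt u else src u
  end.

Fixpoint tbd (e : bool) i (t : term i) : term i.-1 :=
  match t in term i return term i.-1 with
  | tgen i x => tgen (bd e x)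
  | tunit i t => t
  | tcomp j i p t t' =>
      (match p in upto _ i return term i -> term i -> term i with
       | upto_refl => fun a b => if e then a else b
       | upto_S _ p => fun a b => tcomp p a b
       end) (tbd e t) (tbd e t')
  | tinv i t => tbd (~~ e) t
  end.

Lemma composable_bd (G : globular_set) e j i (p : upto j i) (u v : G i.+2) :
  composable (upto_S p) u v -> composable p (bd e u) (bd e v).
Proof. by case: e; rewrite /composable /= ?src_tgt ?tgt_src. Qed.

Lemma ev_tbd (H : strict_groupoid) (g : globular_map X H) e i (t : term i) a :
  ev g t a -> ev g (tbd e t) (bd e a).
Proof.
elim: t e a => {i} [i x|i t IH|j i p t IH t' IH'|i t IH] e a /=.
- by move=> ->; case: i x {a} => //= i x; case: e; rewrite ?gmap_src ?gmap_tgt.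
- by move=> [b [tb ->]]; case: e; rewrite ?src_unit ?tgt_unit.
- move=> [b [c [tb [tc [E ->]]]]].
  move: (IH e _ tb) (IH' e _ tc); move: (tbd e t) (tbd e t') => /= s s'.
  case: p t IH t' IH' b c tb tc E s s' => [|k p] t _ t' _ b c _ _ E s s' sb sc.
    by case: e sb sc; rewrite ?src_comp_top ?tgt_comp_top.
  exists (bd e b), (bd e c); split=> //; split=> //.
  exists (composable_bd e E); case: e {sb sc}.
  + exact: tgt_comp.
  + exact: src_comp.
- move=> [b [tb [H1 [H2 _]]]]; have := IH (~~ e) _ tb.
  by case: e => /=; [rewrite (H1 : src b = tgt a) | rewrite (H2 : src a = tgt b)].
Qed.

Definition valid i (t : term i) :=
  forall (H : strict_groupoid) (g : globular_map X H), exists a, ev g t a.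

Definition vterm i := {t : term i | valid t}.

Definition vterm_eqb i : rel {classic (vterm i)} := fun t t' =>
  `[< forall (H : strict_groupoid) (g : globular_map X H) a,
        ev g (sval t) a <-> ev g (sval t') a >].

Lemma vterm_eqb_equiv i : equiv_class_of (@vterm_eqb i).
Proof.
split=> [t|t t'|t2 t1 t3].
- exact/asboolP.
- by apply/asboolP/asboolP => h H g a; apply: iff_sym.
- by move=> /asboolP h1 /asboolP h2; apply/asboolP => H g a; apply: iff_trans (h2 H g a).
Qed.

Canonical vterm_equiv_rel i := EquivRelPack (@vterm_eqb_equiv i).

Definition fcell i : Type := {eq_quot (@vterm_eqb i)}.

Definition fclass i (t : term i) (V : valid t) : fcell i :=
  \pi_({eq_quot (@vterm_eqb i)}) (exist _ t V : {classic (vterm i)}).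

Definition frepr i (c : fcell i) : term i :=
  sval (repr (c : {eq_quot (@vterm_eqb i)}) : vterm i).

Lemma frepr_valid i (c : fcell i) : valid (frepr c).
Proof. exact: proj2_sig. Qed.

Definition fval (H : strict_groupoid) (g : globular_map X H) i (c : fcell i) : H i :=
  projT1 (cid (frepr_valid c g)).

Lemma ev_fval (H : strict_groupoid) (g : globular_map X H) i (c : fcell i) :
  ev g (frepr c) (fval g c).
Proof. exact: projT2 (cid (frepr_valid c g)). Qed.

Lemma fclassK i (c : fcell i) (V : valid (frepr c)) : fclass V = c.
Proof.
rewrite -[RHS](@reprK _ {eq_quot (@vterm_eqb i)}); congr (\pi _).
by move: V; rewrite /frepr; case: (repr _) => t Vt /= V; rewrite (Prop_irrelevance V Vt).
Qed.

Lemma fval_class (H : strict_groupoid) (g : globular_map X H) i (t : term i)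
    (V : valid t) a : ev g t a -> fval g (fclass V) = a.
Proof.
move=> ta; apply: ev_fun (ev_fval g (fclass V)) _.
suff /asboolP : vterm_eqb (exist _ t V) (repr (fclass V : {eq_quot (@vterm_eqb i)})).
  by move=> h; apply/h.
by apply/eqmodP; rewrite reprK.
Qed.

Lemma fval_inj i (c d : fcell i) :
  (forall (H : strict_groupoid) (g : globular_map X H), fval g c = fval g d) -> c = d.
Proof.
move=> e; rewrite -[c](@reprK _ {eq_quot (@vterm_eqb i)}).
rewrite -[d](@reprK _ {eq_quot (@vterm_eqb i)}); apply/eqmodP/asboolP => H g a.
split=> h.
- by rewrite (ev_fun h (ev_fval g c)) e; apply: ev_fval.
- by rewrite (ev_fun h (ev_fval g d)) -e; apply: ev_fval.
Qed.

Lemma fbd_valid e i (c : fcell i.+1) : valid (tbd e (frepr c)).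
Proof. by move=> H g; exists (bd e (fval g c)); apply/ev_tbd/ev_fval. Qed.

Definition fsrc i (c : fcell i.+1) : fcell i := fclass (fbd_valid false c).
Definition ftgt i (c : fcell i.+1) : fcell i := fclass (fbd_valid true c).

Lemma fval_src (H : strict_groupoid) (g : globular_map X H) i (c : fcell i.+1) :
  fval g (fsrc c) = src (fval g c).
Proof. exact: fval_class (ev_tbd false (ev_fval g c)). Qed.

Lemma fval_tgt (H : strict_groupoid) (g : globular_map X H) i (c : fcell i.+1) :
  fval g (ftgt c) = tgt (fval g c).
Proof. exact: fval_class (ev_tbd true (ev_fval g c)). Qed.

Definition fglob : globular_set.
Proof.
apply: (@GlobularSet fcell fsrc ftgt) => i u; apply: fval_inj => H g;
  by rewrite !(fval_src, fval_tgt) ?src_tgt ?tgt_src.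
Defined.

Definition fval_map (H : strict_groupoid) (g : globular_map X H) : globular_map fglob H :=
  @GlobularMap fglob H (fval g) (fval_src g) (fval_tgt g).

Lemma gmap_isrc (G G' : globular_set) (f : globular_map G G') j i (p : upto j i) u :
  f j (isrc p u) = isrc p (f i u).
Proof. by elim: p u => //= k p IH u; rewrite IH gmap_src. Qed.

Lemma gmap_itgt (G G' : globular_set) (f : globular_map G G') j i (p : upto j i) u :
  f j (itgt p u) = itgt p (f i u).
Proof. by elim: p u => //= k p IH u; rewrite IH gmap_tgt. Qed.

Lemma gmap_composable (G G' : globular_set) (f : globular_map G G') j i
    (p : upto j i) u v : composable p u v -> composable p (f i.+1 u) (f i.+1 v).
Proof. by rewrite /composable -gmap_isrc -gmap_itgt => ->. Qed.

Lemma fval_isrc (H : strict_groupoid) (g : globular_map X H) j i (p : upto j i)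
    (c : fglob i) : fval g (isrc p c) = isrc p (fval g c).
Proof. exact: (gmap_isrc (fval_map g)). Qed.

Lemma fval_itgt (H : strict_groupoid) (g : globular_map X H) j i (p : upto j i)
    (c : fglob i) : fval g (itgt p c) = itgt p (fval g c).
Proof. exact: (gmap_itgt (fval_map g)). Qed.

Lemma funit_valid i (c : fcell i) : valid (tunit (frepr c)).
Proof. by move=> H g; exists (unit_cell (fval g c)), (fval g c); split=> //; apply: ev_fval. Qed.

Definition funit i (c : fcell i) : fcell i.+1 := fclass (funit_valid c).

Lemma fval_unit (H : strict_groupoid) (g : globular_map X H) i (c : fcell i) :
  fval g (funit c) = unit_cell (fval g c).
Proof. by apply: fval_class; exists (fval g c); split=> //; apply: ev_fval. Qed.

Lemma ev_fcomp j i (p : upto j i) (c d : fglob i.+1) (E : composable p c d)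
    (H : strict_groupoid) (g : globular_map X H) :
  ev g (tcomp p (frepr c) (frepr d)) (comp p (gmap_composable (fval_map g) E)).
Proof.
exists (fval g c), (fval g d); split; first exact: ev_fval.
by split; [exact: ev_fval | exists (gmap_composable (fval_map g) E)].
Qed.

Lemma fcomp_valid j i (p : upto j i) (c d : fglob i.+1) :
  composable p c d -> valid (tcomp p (frepr c) (frepr d)).
Proof. by move=> E H g; exists (comp p (gmap_composable (fval_map g) E)); apply: ev_fcomp. Qed.

Definition fcomp j i (p : upto j i) (c d : fglob i.+1) (E : composable p c d) :
  fglob i.+1 := fclass (fcomp_valid E).

Lemma fval_comp j i (p : upto j i) (c d : fglob i.+1) (E : composable p c d)
    (H : strict_groupoid) (g : globular_map X H)
    (E' : composable p (fval g c) (fval g d)) :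
  fval g (fcomp E) = comp p E'.
Proof. by rewrite (fval_class _ (ev_fcomp E g)); apply: comp_congr. Qed.

Lemma fval_iunit (H : strict_groupoid) (g : globular_map X H) j i (p : upto j i)
    (c : fglob j) : fval g (iunit (G := fglob) funit p c) = iid p (fval g c).
Proof. by elim: p => //= k p IH; rewrite fval_unit IH. Qed.

(* [u *_p v = w] as a relation, to transfer axioms along [fval]. *)
Definition is_comp (G : strict_category) j i (p : upto j i) (u v w : G i.+1) :=
  exists E : composable p u v, w = comp p E.

Lemma fval_is_comp j i (p : upto j i) (c d : fglob i.+1) (E : composable p c d)
    (H : strict_groupoid) (g : globular_map X H) :
  is_comp p (fval g c) (fval g d) (fval g (fcomp E)).
Proof. by exists (gmap_composable (fval_map g) E); apply: fval_comp. Qed.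

Definition fcat : strict_category.
Proof.
apply: (@StrictCategory fglob funit fcomp).
- by move=> i u; apply: fval_inj => H g; rewrite fval_src fval_unit src_unit.
- by move=> i u; apply: fval_inj => H g; rewrite fval_tgt fval_unit tgt_unit.
- move=> i u v E; apply: fval_inj => H g; rewrite !fval_src.
  by have [E' ->] := fval_is_comp E g; rewrite src_comp_top.
- move=> i u v E; apply: fval_inj => H g; rewrite !fval_tgt.
  by have [E' ->] := fval_is_comp E g; rewrite tgt_comp_top.
- move=> j i p u v E F; apply: fval_inj => H g; rewrite fval_src.
  have [E' ->] := fval_is_comp E g; have [F' ->] := fval_is_comp F g.
  move: F'; rewrite (fval_src g u) (fval_src g v) => F'; exact: src_comp.
- move=> j i p u v E F; apply: fval_inj => H g; rewrite fval_tgt.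
  have [E' ->] := fval_is_comp E g; have [F' ->] := fval_is_comp F g.
  move: F'; rewrite (fval_tgt g u) (fval_tgt g v) => F'; exact: tgt_comp.
- move=> j i p u v w E1 E2 E3 E4; apply: fval_inj => H g.
  have [F3 ->] := fval_is_comp E3 g; have [F4 ->] := fval_is_comp E4 g.
  have [F1 e1] := fval_is_comp E1 g; have [F2 e2] := fval_is_comp E2 g.
  move: F3 F4; rewrite e1 e2 => F3 F4; exact: comp_assoc.
- move=> j k i p q u u' v v' E1 E2 E3 E4 E5 E6 ltjk; apply: fval_inj => H g.
  have [F5 ->] := fval_is_comp E5 g; have [F6 ->] := fval_is_comp E6 g.
  have [F1 e1] := fval_is_comp E1 g; have [F2 e2] := fval_is_comp E2 g.
  have [F3 e3] := fval_is_comp E3 g; have [F4 e4] := fval_is_comp E4 g.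
  move: F5 F6; rewrite e1 e2 e3 e4 => F5 F6; exact: exchange.
- move=> j i p u E; apply: fval_inj => H g.
  have [F ->] := fval_is_comp E g; move: F.
  rewrite (fval_iunit g (upto_S p)) (fval_itgt g (upto_S p)) => F.
  exact: comp_unit_l.
- move=> j i p u E; apply: fval_inj => H g.
  have [F ->] := fval_is_comp E g; move: F.
  rewrite (fval_iunit g (upto_S p)) (fval_isrc g (upto_S p)) => F.
  exact: comp_unit_r.
- move=> j i p u v E E'; apply: fval_inj => H g; rewrite fval_unit.
  have [F ->] := fval_is_comp E g; have [F' ->] := fval_is_comp E' g.
  move: F'; rewrite !fval_unit => F'; exact: unit_comp.
Defined.

Lemma ev_finv (H : strict_groupoid) (g : globular_map X H) i (c : fcell i.+1) b :
  is_inverse (fval g c) b -> ev g (tinv (frepr c)) b.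
Proof. by exists (fval g c); split=> //; apply: ev_fval. Qed.

Lemma finv_valid i (c : fcell i.+1) : valid (tinv (frepr c)).
Proof.
by move=> H g; have [b Ib] := has_inverse (fval g c); exists b; apply: ev_finv.
Qed.

Lemma fcat_is_inverse i (c d : fcat i.+1) :
  (forall (H : strict_groupoid) (g : globular_map X H),
     is_inverse (fval g c) (fval g d)) -> is_inverse c d.
Proof.
move=> I.
have E : composable upto_refl c d.
  apply: fval_inj => H g; rewrite fval_src fval_tgt.
  by have [E _] := I H g; exact: E.
have F : composable upto_refl d c.
  apply: fval_inj => H g; rewrite fval_src fval_tgt.
  by have [_ [F _]] := I H g; exact: F.
exists E, F; split; apply: fval_inj => H g; have [E' [F' [e f]]] := I H g.
- by rewrite (fval_comp _ E') e fval_unit fval_tgt.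
- by rewrite (fval_comp _ F') f fval_unit fval_src.
Qed.

Lemma fcat_has_inverse i (c : fcat i.+1) : exists d, is_inverse c d.
Proof.
exists (fclass (finv_valid c)); apply: fcat_is_inverse => H g.
have [b Ib] := has_inverse (fval g c).
by rewrite (fval_class _ (ev_finv Ib)).
Qed.

Definition free : strict_groupoid := StrictGroupoid fcat_has_inverse.

Lemma tgen_valid i (x : X i) : valid (tgen x).
Proof. by move=> H g; exists (g i x). Qed.

Lemma fval_gen (H : strict_groupoid) (g : globular_map X H) i (x : X i) :
  fval g (fclass (tgen_valid x)) = g i x.
Proof. exact: fval_class. Qed.

Definition free_unit : globular_map X free.
Proof.
apply: (@GlobularMap X free (fun i x => fclass (tgen_valid x))) => i u.
- by apply: fval_inj => H g; rewrite fval_src !fval_gen gmap_src.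
- by apply: fval_inj => H g; rewrite fval_tgt !fval_gen gmap_tgt.
Defined.

Definition free_lift (H : strict_groupoid) (g : globular_map X H) :
  strict_functor free H.
Proof.
apply: (@StrictFunctor free H (fval_map g)); first exact: fval_unit.
by move=> j i p u v E E'; apply: fval_comp.
Defined.

Lemma fmap_is_inverse (G H : strict_category) (f : strict_functor G H) i (u v : G i.+1) :
  is_inverse u v -> is_inverse (fmap f i.+1 u) (fmap f i.+1 v).
Proof.
move=> [E [F [e1 e2]]].
exists (gmap_composable f E), (gmap_composable f F).
by rewrite -!fmap_comp e1 e2 !fmap_unit gmap_src gmap_tgt.
Qed.

Lemma free_lift_uniq (H : strict_groupoid) (g : globular_map X H)
    (f : strict_functor free H) :
  (forall i (x : X i), fmap f i (free_unit i x) = g i x) ->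
  forall i (c : free i), fmap f i c = fval g c.
Proof.
move=> fg.
have main i (t : term i) : forall V : valid t, fmap f i (fclass V) = fval g (fclass V).
  elim: t => {i} [i x|i t IH|j i p t IH t' IH'|i t IH] V.
  - by rewrite (Prop_irrelevance V (tgen_valid x)) fval_gen -fg.
  - have Vt : valid t by move=> H' g'; have [_ [b [tb _]]] := V H' g'; exists b.
    have -> : fclass V = unit_cell (fclass Vt : free i).
      apply: fval_inj => H' g'; rewrite fval_unit.
      have [a ta] := V H' g'; rewrite (fval_class _ ta).
      by move: ta => /= [b [tb ->]]; rewrite (fval_class _ tb).
    by rewrite fmap_unit IH fval_unit.
  - have Vt : valid t by move=> H' g'; have [_ [b [c [tb _]]]] := V H' g'; exists b.
    have Vt' : valid t' by move=> H' g'; have [_ [b [c [_ [tc _]]]]] := V H' g'; exists c.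
    have E : composable p (fclass Vt : free i.+1) (fclass Vt').
      apply: fval_inj => H' g'.
      rewrite (fval_isrc g' (upto_S p)) (fval_itgt g' (upto_S p)).
      have [_ [b [c [tb [tc [E _]]]]]] := V H' g'.
      by move: E; rewrite -(fval_class Vt tb) -(fval_class Vt' tc).
    have -> : fclass V = comp p E.
      apply: fval_inj => H' g'; have [F ->] := fval_is_comp E g'.
      have [a ta] := V H' g'; rewrite (fval_class _ ta).
      move: ta => /= [b [c [tb [tc [F' ->]]]]].
      by apply: comp_congr; rewrite ?(fval_class _ tb) ?(fval_class _ tc).
    rewrite (fmap_comp E (gmap_composable f E)).
    by have [F ->] := fval_is_comp E g; apply: comp_congr.
  - have Vt : valid t by move=> H' g'; have [_ [b [tb _]]] := V H' g'; exists b.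
    have I (H' : strict_groupoid) (g' : globular_map X H') :
        is_inverse (fval g' (fclass Vt)) (fval g' (fclass V)).
      have [a ta] := V H' g'; rewrite (fval_class _ ta).
      by move: ta => /= [b [tb]]; rewrite (fval_class _ tb).
    have := @fmap_is_inverse _ _ f _ _ _ (fcat_is_inverse I).
    by rewrite IH => J; apply: is_inverse_uniq J (I H g).
by move=> i c; rewrite -(fclassK (frepr_valid c)); apply: main.
Qed.

End Free.

Definition free_left_adjoint : left_adjoint.
Proof.
apply: (@LeftAdjoint free free_unit) => X H g.
exists (free_lift g); split=> [i x|f fg i u]; first exact: fval_gen.
exact: free_lift_uniq.
Defined.

(* Main.v *)
From HB Require Import structures.
From mathcomp Require Import all_boot ssralg ssrint boolp.
From mathcomp Require Import zify.
Require Import Defs.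

(** The groupoid L(D_n) is a retract of an explicit strict infinity-groupoid
    in which any two parallel cells are joined by a cell.

    The explicit groupoid C ([coord_groupoid]) is the product over m of groupoids
    K_m with a single cell in each dimension below m, the integers as m-cells
    (composed by addition if m > 0) and exactly one (m+1)-cell between any two m-cells.
    For every n it has a distinguished n-cell d_n ([disk_coord]), so the
    universal property gives a functor s : L(D_n) -> C sending the generator to
    d_n.  If q : C -> L(D_n) sends d_n back to the generator, then q s fixes the
    generator, hence is the identity, and two parallel cells of L(D_n) are
    joined by the image under q of a cell of C ([weakly_contractible_retract]).

    Such a q exists for every n-cell e of every strict infinity-groupoid G
    ([cell_through_coord]).  Fix an object x.  The (i+1)-cells whose 0-source and
    0-target are x form a group M_i under the composition along 0-cells, and
    sources, targets and units are homomorphisms between these groups.  The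
    exchange law has two consequences: every higher composite of u and v is
    u (k s u)^-1 v ([paste_pcell]), and an element with trivial j-source
    commutes with an element with trivial j-target ([pcell_commute]).

    Let x be the 0-source of e, and let w_i in M_(i+1) be the difference of two
    consecutive iterated sources of e, translated to x (above the dimension of e,
    iterated units take the place of sources and w_i = 1).  Its source is 1, and its
    target c_i lies in M_i.  By the second consequence all iterated units of all
    w_i and c_i commute with each other.  Hence the ordered product of their powers is
    additive in the exponents ([prod_cellD]), and the first consequence turns
    additivity into compatibility with all higher compositions ([paste_P]).  This
    product, conjugated by the 1-source of e to reach the second object, is
    the functor q ([realize]); the product with exponents d_n telescopes to e
    ([prod_cell_eps], [realize_disk]). *)

Set Implicit Arguments.
Unset Strict Implicit.
Unset Printing Implicit Defensive.

(** * Comparison of dimensions *)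

Lemma upto_leq j i (p : upto j i) : j <= i.
Proof. by elim: p => // k p; exact: leqW. Qed.

Lemma leq_upto j i : j <= i -> upto j i.
Proof.
elim: i => [|i IH]; first by rewrite leqn0 => /eqP->; exact: upto_refl.
by case: (ltnP i j) => [lt le|le _]; [rewrite (@anti_leq i.+1 j) ?lt ?le //; exact: upto_refl
  | exact/upto_S/IH].
Qed.

Lemma upto_inv j i (p : upto j i) :
  (exists e : j = i, p = eq_rect j (upto j) upto_refl i e) \/
  j < i /\ match i return upto j i -> Prop with
  | 0 => fun=> False
  | k.+1 => fun p => exists q, p = upto_S q
  end p.
Proof.
case: p => [|k p]; first by left; exists erefl.
by right; split; [exact: upto_leq p | exists p].
Qed.

Lemma upto_irrelevance j i (p q : upto j i) : p = q.
Proof.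
elim: p q => [|k p IH] q.
  by case: (upto_inv q) => [[e ->]|[]]; rewrite ?(eq_irrelevance e erefl) // ltnn.
case: (upto_inv q) => [[e _]|[_ [r ->]]]; last by rewrite (IH r).
by exfalso; have := upto_leq p; apply/negP; rewrite -ltnNge -e.
Qed.

Fixpoint upto_shift j i (p : upto j i) : upto j.+1 i.+1 :=
  match p in upto _ i return upto j.+1 i.+1 with
  | upto_refl => upto_refl
  | upto_S _ p => upto_S (upto_shift p)
  end.

(** This allows induction on a comparison of two positive dimensions. *)
Lemma upto_shiftP j i (p : upto j.+1 i.+1) : exists r, p = upto_shift r.
Proof.
exists (leq_upto (upto_leq p : j <= i)); exact: upto_irrelevance.
Qed.

Lemma upto_predS j k (p : upto j.+1 k) (q : upto j k.+1) :
  exists r : upto j k, q = upto_S r.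
Proof. exists (leq_upto (ltnW (upto_leq p))); exact: upto_irrelevance. Qed.

Section IteratedBoundaries.
Variables j i : nat.
Variables (p : upto j.+1 i) (q : upto j i).

Lemma src_isrc (G : globular_set) (u : G i) : src (isrc p u) = isrc q u.
Proof.
elim: p q u => [|k p' IH] q' u; first by rewrite (upto_irrelevance q' (upto_S upto_refl)).
by have [r ->] := upto_predS p' q'; rewrite /= -IH.
Qed.

Lemma tgt_itgt (G : globular_set) (u : G i) : tgt (itgt p u) = itgt q u.
Proof.
elim: p q u => [|k p' IH] q' u; first by rewrite (upto_irrelevance q' (upto_S upto_refl)).
by have [r ->] := upto_predS p' q'; rewrite /= -IH.
Qed.

Lemma iid_unit (G : strict_category) (u : G j) : iid p (unit_cell u) = iid q u.
Proof.
rewrite /iid; elim: p q => [|k p' IH] q'; first by rewrite (upto_irrelevance q' (upto_S upto_refl)).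
by have [r ->] := upto_predS p' q'; rewrite /= -(IH r).
Qed.

End IteratedBoundaries.

Lemma isrc_iid (G : strict_category) j i (p : upto j i) (u : G j) : isrc p (iid p u) = u.
Proof. by rewrite /iid; elim: p => //= k p IH; rewrite src_unit. Qed.

(** Iterated sources and iterated units fit together into one sequence through
    a given cell, so that constructions from a cell need not distinguish
    dimensions below and above its own. *)
Lemma source_tower (G : strict_category) n (e : G n) :
  exists eps : forall i, G i, (forall i, src (eps i.+1) = eps i) /\ eps n = e.
Proof.
(* The i-th term is the i-source of the iterated unit of e in dimension i + n. *)
pose p i := leq_upto (leq_addr n i); pose q i := leq_upto (leq_addl i n).
exists (fun i => isrc (p i) (iid (q i) e)); split=> [i|].
  rewrite (src_isrc _ (upto_S (p i))) (upto_irrelevance (q i.+1) (upto_S (q i))) /=.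
  by rewrite src_unit.
by rewrite (upto_irrelevance (p n) (q n)) isrc_iid.
Qed.

(** * The groupoid of integer coordinates *)

Local Notation coord := (nat -> (int * int)%type).

(** The m-th coordinate of an i-cell is the pair of its m-source and m-target in
    the factor K_m: these are arbitrary for m < i, they are both the cell itself
    for m = i, and they are both 0, the m-dimensional unit, for m > i. *)
Record ccell i := CCell {
  cval :> nat -> (int * int)%type;
  cval_ge : forall m, i <= m -> (cval m).1 = (cval m).2;
  cval_gt : forall m, i < m -> (cval m).1 = 0%R
}.

Lemma pair_ext (p q : int * int) : p.1 = q.1 -> p.2 = q.2 -> p = q.
Proof. by case: p q => a b [c d] /= -> ->. Qed.

Lemma ccell_ext i (u v : ccell i) : (forall m, u m = v m) -> u = v.
Proof.
case: u v => [u u1 u2] [v v1 v2] /= e.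
have {}e : u = v by apply/funext.
case: v / e v1 v2 => v1 v2.
by rewrite (Prop_irrelevance v1 u1) (Prop_irrelevance v2 u2).
Qed.

(** The j-source (e = false) or j-target (e = true), in coordinates. *)
Definition trunc (e : bool) j (c : coord) : coord := fun m =>
  if m < j then c m
  else if m == j then let z := if e then (c m).2 else (c m).1 in (z, z)
  else (0, 0)%R.

Lemma trunc_trunc e e' j i c m : j < i -> trunc e j (trunc e' i c) m = trunc e j c m.
Proof.
move=> ji; rewrite /trunc; case: (ltngtP m j) => // mj.
  by rewrite (ltn_trans mj ji).
by rewrite mj ji.
Qed.

Lemma trunc_same e j i c m : j <= i -> trunc e j (trunc e i c) m = trunc e j c m.
Proof.
rewrite leq_eqVlt => /orP[/eqP <-|/trunc_trunc //].
by rewrite /trunc; case: (ltngtP m j) => //; case: e.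
Qed.

Lemma trunc_id e i (u : ccell i) m : trunc e i u m = u m.
Proof.
rewrite /trunc; case: ltngtP => // mi; apply: pair_ext; rewrite /=.
- by rewrite cval_gt.
- by rewrite -cval_ge ?cval_gt // ltnW.
- by case: e => //; rewrite -cval_ge // mi.
- by case: e => //; rewrite -cval_ge // mi.
Qed.

Lemma trunc_cell e i (c : coord) :
  (forall m, i <= m -> (trunc e i c m).1 = (trunc e i c m).2) /\
  (forall m, i < m -> (trunc e i c m).1 = 0%R).
Proof. by rewrite /trunc; split=> m mi; case: ltngtP mi. Qed.

Definition cbd e i (c : coord) : ccell i :=
  CCell (proj1 (trunc_cell e i c)) (proj2 (trunc_cell e i c)).

Definition coord_glob : globular_set.
Proof.
by apply: (@GlobularSet ccell (fun i u => cbd false i u) (fun i u => cbd true i u)) => i u;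
  apply: ccell_ext => m; rewrite /= !trunc_trunc.
Defined.

Definition cunit i (u : coord_glob i) : coord_glob i.+1 :=
  CCell (fun m im => cval_ge u (ltnW im)) (fun m im => cval_gt u (ltnW im)).

Definition addc (c d : coord) : coord := fun m => ((c m).1 + (d m).1, (c m).2 + (d m).2)%R.

(** Composition along j-cells concatenates in the factors K_m with m <= j, and
    adds in the others. *)
Definition pastec j (c d : coord) : coord := fun m =>
  if m <= j then ((d m).1, (c m).2) else addc c d m.

Lemma pastec_cell j i (p : upto j i) (u v : ccell i.+1) :
  (forall m, i < m -> (pastec j u v m).1 = (pastec j u v m).2) /\
  (forall m, i.+1 < m -> (pastec j u v m).1 = 0%R).
Proof.
have ji := upto_leq p; rewrite /pastec /addc; split=> m im.
  by rewrite leqNgt (leq_ltn_trans ji im) /= !cval_ge.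
by rewrite leqNgt (leq_ltn_trans ji (ltnW im)) /= !cval_gt.
Qed.

Definition ccomp j i (p : upto j i) (u v : coord_glob i.+1) (_ : composable p u v) :
  coord_glob i.+1 :=
  CCell (proj1 (pastec_cell p u v)) (proj2 (pastec_cell p u v)).

Lemma isrcE j i (p : upto j i) (u : coord_glob i) m : isrc p u m = trunc false j u m.
Proof.
elim: p u => [|k p IH] u /=; first by rewrite trunc_id.
by rewrite IH /= trunc_same // upto_leq.
Qed.

Lemma itgtE j i (p : upto j i) (u : coord_glob i) m : itgt p u m = trunc true j u m.
Proof.
elim: p u => [|k p IH] u /=; first by rewrite trunc_id.
by rewrite IH /= trunc_same // upto_leq.
Qed.

Lemma iunitE j i (p : upto j i) (u : coord_glob j) m : iunit cunit p u m = u m.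
Proof. by elim: p. Qed.

Lemma ccomposable j i (p : upto j i) (u v : coord_glob i.+1) : composable p u v ->
  (forall m, m < j -> u m = v m) /\ (u j).1 = (v j).2.
Proof.
move=> E; have e m : trunc false j u m = trunc true j v m.
  by rewrite -(isrcE (upto_S p)) -(itgtE (upto_S p)) E.
split=> [m mj|]; first by have := e m; rewrite /trunc mj.
by have := e j; rewrite /trunc ltnn eqxx => -[].
Qed.

Definition coord_cat : strict_category.
Proof.
apply: (@StrictCategory coord_glob cunit ccomp).
- by move=> i u; apply: ccell_ext => m; rewrite /= trunc_id.
- by move=> i u; apply: ccell_ext => m; rewrite /= trunc_id.
- move=> i u v /[dup] /ccomposable[E _] H; apply: ccell_ext => m; rewrite /= /trunc /pastec.
  by case: ltngtP => // mi; rewrite (E _ mi) -surjective_pairing.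
- move=> i u v /[dup] /ccomposable[E _] H; apply: ccell_ext => m; rewrite /= /trunc /pastec.
  by case: ltngtP => // mi; rewrite -(E _ mi) -surjective_pairing.
- move=> j i p u v H H'; apply: ccell_ext => m; have ji := upto_leq p.
  rewrite /= /trunc /pastec /addc; case: (ltngtP m i.+1) => // mi.
    by case: ifP.
  by rewrite mi leqNgt ltnS ji.
- move=> j i p u v H H'; apply: ccell_ext => m; have ji := upto_leq p.
  rewrite /= /trunc /pastec /addc; case: (ltngtP m i.+1) => // mi.
    by case: ifP.
  by rewrite mi leqNgt ltnS ji.
- move=> j i p u v w H1 H2 H3 H4; apply: ccell_ext => m; rewrite /= /pastec /addc.
  by case: (m <= j) => //=; rewrite !GRing.addrA.
- move=> j k i p q u u' v v' H1 H2 H3 H4 H5 H6 jk; apply: ccell_ext => m; rewrite /= /pastec /addc.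
  case: (leqP m j) => mj; first by rewrite (leq_trans mj (ltnW jk)).
  by case: (m <= k) => //=; apply: pair_ext; rewrite /= GRing.addrACA.
- move=> j i p u H; apply: ccell_ext => m; rewrite /= /pastec /addc iunitE (itgtE p) /=.
  rewrite (trunc_same _ _ _ (upto_leq p)) /trunc.
  by case: (ltngtP m j) => mj; apply: pair_ext; rewrite /= ?GRing.add0r.
- move=> j i p u H; apply: ccell_ext => m; rewrite /= /pastec /addc iunitE (isrcE p) /=.
  rewrite (trunc_same _ _ _ (upto_leq p)) /trunc.
  by case: (ltngtP m j) => mj; apply: pair_ext; rewrite /= ?GRing.addr0.
- by move=> j i p u v H H'; apply: ccell_ext.
Defined.

Lemma cinv_cell i (u : ccell i.+1) (c := fun m => if m < i then u m else
     if m == i then ((u m).2, (u m).1) else (- (u m).1, - (u m).2)%R) :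
  (forall m, i < m -> (c m).1 = (c m).2) /\ (forall m, i.+1 < m -> (c m).1 = 0%R).
Proof.
rewrite /c; split=> m mi; have im : i < m by lia.
  by rewrite ltnNge (ltnW im) gtn_eqF //= cval_ge.
by rewrite ltnNge (ltnW im) gtn_eqF //= cval_gt.
Qed.

Lemma coord_has_inverse i (u : coord_cat i.+1) : exists v, is_inverse u v.
Proof.
pose v : coord_cat i.+1 := CCell (proj1 (cinv_cell u)) (proj2 (cinv_cell u)).
have Huv : composable upto_refl u v.
  by apply: ccell_ext => m; rewrite /= /trunc; case: ltngtP.
have Hvu : composable upto_refl v u.
  by apply: ccell_ext => m; rewrite /= /trunc; case: ltngtP.
exists v, Huv, Hvu; split; apply: ccell_ext => m;
  rewrite /= /pastec /addc /trunc /=; case: (ltngtP m i) => mi; apply: pair_ext;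
  by rewrite /= ?GRing.subrr ?GRing.addNr.
Qed.

Definition coord_groupoid : strict_groupoid := StrictGroupoid coord_has_inverse.

(** Cells u and v agreeing below their dimension i are joined by the cell with
    m-source that of u and m-target that of v, for every m. *)
Lemma coord_homotopic i (u v : coord_groupoid i) :
  (forall m, m < i -> u m = v m) -> homotopic u v.
Proof.
move=> uv; pose c : coord := fun m => ((u m).1, (v m).2).
have c1 m : i < m -> (c m).1 = (c m).2.
  by move=> im; rewrite /= -(cval_ge v (ltnW im)) !cval_gt.
have c2 m : i.+1 < m -> (c m).1 = 0%R by move=> im; rewrite /= cval_gt // ltnW.
exists (CCell c1 c2); split; apply: ccell_ext => m; rewrite /= /trunc /c.
- case: (ltngtP m i) => mi /=; apply: pair_ext => //=.
  + by rewrite uv.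
  + by rewrite cval_gt.
  + by rewrite -cval_ge ?cval_gt // ltnW.
  + by rewrite cval_ge // mi.
- case: (ltngtP m i) => mi /=; apply: pair_ext => //=.
  + by rewrite uv.
  + by rewrite cval_gt.
  + by rewrite -cval_ge ?cval_gt // ltnW.
  + by rewrite cval_ge // mi.
Qed.

Lemma coord_parallel i (u v : coord_groupoid i.+1) :
  src u = src v -> tgt u = tgt v -> homotopic u v.
Proof.
move=> su tv; apply: coord_homotopic => m mi.
have := congr1 (fun w : ccell i => cval w m) su.
have := congr1 (fun w : ccell i => cval w m) tv.
rewrite /= /trunc; move: mi; rewrite ltnS; case: ltngtP => // -> _ [e2 _] [e1 _].
exact: pair_ext.
Qed.

Definition disk_coord_raw n : coord := fun m => (0%R, Posz (m < n)).

Lemma disk_coord_cell n :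
  (forall m, n <= m -> (disk_coord_raw n m).1 = (disk_coord_raw n m).2) /\
  (forall m, n < m -> (disk_coord_raw n m).1 = 0%R).
Proof. by split=> // m; rewrite /= leqNgt => /negbTE ->. Qed.

(** It goes from 0 to 1 in each factor K_m with m < n, so that a functor given by
    products of powers uses each difference of consecutive sources of an n-cell
    exactly once, and recovers the n-cell. *)
Definition disk_coord n : coord_groupoid n :=
  CCell (proj1 (disk_coord_cell n)) (proj2 (disk_coord_cell n)).

(** * Composition along objects *)

Section TotalComposition.
Variable G : strict_category.

(** Composition made total, so that equations between composites can be
    rewritten without carrying composability proofs inside terms. *)
Definition paste j i (p : upto j i) (u v : G i.+1) : G i.+1 :=
  if pselect (composable p u v) is left E then comp p E else u.

Lemma pasteE j i (p : upto j i) (u v : G i.+1) (E : composable p u v) :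
  paste p u v = comp p E.
Proof.
by rewrite /paste; case: pselect => // E'; apply: comp_congr.
Qed.

Definition src0 i (u : G i) : G 0 := isrc (upto0 i) u.
Definition tgt0 i (u : G i) : G 0 := itgt (upto0 i) u.
Definition paste0 i (u v : G i.+1) : G i.+1 := paste (upto0 i) u v.
Definition unit0 i (z : G 0) : G i := iid (upto0 i) z.

Lemma src0_src i (u : G i.+1) : src0 (src u) = src0 u. Proof. by []. Qed.
Lemma tgt0_tgt i (u : G i.+1) : tgt0 (tgt u) = tgt0 u. Proof. by []. Qed.
Lemma src0_tgt i (u : G i.+2) : src0 (tgt u) = src0 u.
Proof. by rewrite /src0 /= src_tgt. Qed.
Lemma tgt0_src i (u : G i.+2) : tgt0 (src u) = tgt0 u.
Proof. by rewrite /tgt0 /= tgt_src. Qed.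
Lemma src0_unit i (u : G i) : src0 (unit_cell u) = src0 u.
Proof. by rewrite -src0_src src_unit. Qed.
Lemma tgt0_unit i (u : G i) : tgt0 (unit_cell u) = tgt0 u.
Proof. by rewrite -tgt0_tgt tgt_unit. Qed.

Lemma src0_unit0 i z : src0 (unit0 i z) = z.
Proof. by elim: i => // i IH; rewrite [unit0 _ _]/= src0_unit. Qed.
Lemma tgt0_unit0 i z : tgt0 (unit0 i z) = z.
Proof. by elim: i => // i IH; rewrite [unit0 _ _]/= tgt0_unit. Qed.

Lemma src_paste0 i (u v : G i.+2) : src0 u = tgt0 v ->
  src (paste0 u v) = paste0 (src u) (src v).
Proof.
move=> E; have E' : composable (upto0 i) (src u) (src v).
  by change (src0 (src u) = tgt0 (src v)); rewrite tgt0_src.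
by rewrite /paste0 (pasteE E) (pasteE E'); exact: src_comp.
Qed.

Lemma tgt_paste0 i (u v : G i.+2) : src0 u = tgt0 v ->
  tgt (paste0 u v) = paste0 (tgt u) (tgt v).
Proof.
move=> E; have E' : composable (upto0 i) (tgt u) (tgt v).
  by change (src0 (tgt u) = tgt0 (tgt v)); rewrite src0_tgt.
by rewrite /paste0 (pasteE E) (pasteE E'); exact: tgt_comp.
Qed.

Lemma unit_paste0 i (u v : G i.+1) : src0 u = tgt0 v ->
  unit_cell (paste0 u v) = paste0 (unit_cell u) (unit_cell v).
Proof.
move=> E; have E' : composable (upto0 i.+1) (unit_cell u) (unit_cell v).
  by change (src0 (unit_cell u) = tgt0 (unit_cell v)); rewrite src0_unit tgt0_unit.
by rewrite /paste0 (pasteE E) (pasteE E'); exact: unit_comp.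
Qed.

Lemma src0_paste j i (p : upto j i) (u v : G i.+1) :
  composable p u v -> src0 (paste p u v) = src0 v.
Proof.
move=> E; rewrite (pasteE E); elim: p u v E => [|k p IH] u v E.
  by rewrite -src0_src src_comp_top.
by rewrite -src0_src (src_comp E (composable_bd false E)) IH.
Qed.

Lemma tgt0_paste j i (p : upto j i) (u v : G i.+1) :
  composable p u v -> tgt0 (paste p u v) = tgt0 u.
Proof.
move=> E; rewrite (pasteE E); elim: p u v E => [|k p IH] u v E.
  by rewrite -tgt0_tgt tgt_comp_top.
by rewrite -tgt0_tgt (tgt_comp E (composable_bd true E)) IH.
Qed.

Lemma src0_paste0 i (u v : G i.+1) : src0 u = tgt0 v -> src0 (paste0 u v) = src0 v.
Proof. exact: (@src0_paste _ _ (upto0 i)). Qed.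
Lemma tgt0_paste0 i (u v : G i.+1) : src0 u = tgt0 v -> tgt0 (paste0 u v) = tgt0 u.
Proof. exact: (@tgt0_paste _ _ (upto0 i)). Qed.

Lemma paste0A i (u v w : G i.+1) : src0 u = tgt0 v -> src0 v = tgt0 w ->
  paste0 (paste0 u v) w = paste0 u (paste0 v w).
Proof.
move=> E F.
have E1 : composable (upto0 i) (paste0 u v) w.
  by change (src0 (paste0 u v) = tgt0 w); rewrite src0_paste0.
have E2 : composable (upto0 i) u (paste0 v w).
  by change (src0 u = tgt0 (paste0 v w)); rewrite tgt0_paste0.
rewrite [LHS](pasteE E1) [RHS](pasteE E2); move: E1 E2.
rewrite /paste0 (pasteE E) (pasteE F) => E1 E2; exact: comp_assoc.
Qed.

Lemma paste_unit_l j i (p : upto j i) (u v : G i.+1) :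
  u = iid (upto_S p) (itgt (upto_S p) v) -> composable p u v -> paste p u v = v.
Proof. by move=> -> E; rewrite (pasteE E); exact: comp_unit_l. Qed.
Lemma paste_unit_r j i (p : upto j i) (u v : G i.+1) :
  v = iid (upto_S p) (isrc (upto_S p) u) -> composable p u v -> paste p u v = u.
Proof. by move=> -> E; rewrite (pasteE E); exact: comp_unit_r. Qed.

Lemma paste01 i (u : G i.+1) z : src0 u = z -> paste0 u (unit0 i.+1 z) = u.
Proof. by move=> <-; apply: paste_unit_r => //; exact/esym/tgt0_unit0. Qed.
Lemma paste10 i (u : G i.+1) z : tgt0 u = z -> paste0 (unit0 i.+1 z) u = u.
Proof. by move=> <-; apply: paste_unit_l => //; exact/src0_unit0. Qed.

Lemma isrc_src0 j i (p : upto j i) (u : G i) : src0 (isrc p u) = src0 u.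
Proof. by elim: p u => //= k p IH u; rewrite IH. Qed.

Lemma itgt_src0 j i (p : upto j.+1 i.+1) (u : G i.+1) : src0 (itgt p u) = src0 u.
Proof. by have [r ->] := upto_shiftP p; elim: r u {p} => //= k p IH u; rewrite IH src0_tgt. Qed.

Lemma composable_src0 j i (p : upto j.+1 i) (u v : G i.+1) :
  composable p u v -> src0 u = src0 v.
Proof. by move=> E; rewrite -(isrc_src0 (upto_S p)) E itgt_src0. Qed.

Lemma isrc_paste0 j i (p : upto j.+1 i.+1) (u v : G i.+1) : src0 u = tgt0 v ->
  isrc p (paste0 u v) = paste0 (isrc p u) (isrc p v).
Proof.
have [r ->] := upto_shiftP p; elim: r u v {p} => //= k p IH u v E.
by rewrite src_paste0 // IH // tgt0_src.
Qed.

Lemma itgt_paste0 j i (p : upto j.+1 i.+1) (u v : G i.+1) : src0 u = tgt0 v ->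
  itgt p (paste0 u v) = paste0 (itgt p u) (itgt p v).
Proof.
have [r ->] := upto_shiftP p; elim: r u v {p} => //= k p IH u v E.
by rewrite tgt_paste0 // IH // src0_tgt.
Qed.

Lemma exchange0 j i (p : upto j.+1 i) (u u' v v' : G i.+1) :
    src0 u = tgt0 u' -> src0 v = tgt0 v' -> composable p u v -> composable p u' v' ->
  paste p (paste0 u u') (paste0 v v') = paste0 (paste p u v) (paste p u' v').
Proof.
move=> E F C D.
have E' : composable (upto0 i) (paste p u v) (paste p u' v').
  change (src0 (paste p u v) = tgt0 (paste p u' v')).
  by rewrite src0_paste // tgt0_paste // -(composable_src0 C).
have C' : composable p (paste0 u u') (paste0 v v').
  by rewrite /composable isrc_paste0 // itgt_paste0 // C D.
rewrite [LHS](pasteE C') [RHS](pasteE E'); move: C' E'.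
rewrite (pasteE C) (pasteE D) /paste0.
rewrite (pasteE (E : composable _ _ _)) (pasteE (F : composable _ _ _)) => C' E'.
exact: esym (exchange _ _ _).
Qed.

End TotalComposition.

(** * The groups of cells based at an object *)

Section PointedCells.
Variables (G : strict_groupoid) (x : G 0).
Local Open Scope group_scope.

(** The index is shifted: [pcell 0] consists of 1-cells. *)
Record pcell i := PCell {
  pval :> G i.+1;
  psrc0 : src0 pval = x;
  ptgt0 : tgt0 pval = x
}.

Lemma pval_inj i (u v : pcell i) : u = v :> G i.+1 -> u = v.
Proof.
case: u v => [u su tu] [v sv tv] /= e; move: sv tv; rewrite -e => sv tv.
by rewrite (Prop_irrelevance sv su) (Prop_irrelevance tv tu).
Qed.

HB.instance Definition _ i := gen_eqMixin (pcell i).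
HB.instance Definition _ i := gen_choiceMixin (pcell i).

Lemma pcell_src0_tgt0 i (u v : pcell i) : src0 u = tgt0 v.
Proof. by rewrite psrc0 ptgt0. Qed.
Hint Resolve pcell_src0_tgt0 : core.

Definition pmul i (u v : pcell i) : pcell i :=
  PCell (etrans (src0_paste0 (pcell_src0_tgt0 u v)) (psrc0 v))
        (etrans (tgt0_paste0 (pcell_src0_tgt0 u v)) (ptgt0 u)).
Definition pone i : pcell i := PCell (src0_unit0 i.+1 x) (tgt0_unit0 i.+1 x).

Lemma pmulA i : associative (@pmul i).
Proof. by move=> u v w; apply: pval_inj => /=; rewrite paste0A. Qed.
Lemma pmul1 i : left_id (@pone i) (@pmul i).
Proof. by move=> u; apply: pval_inj => /=; rewrite (paste10 (ptgt0 u)). Qed.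
Lemma pmulr1 i : right_id (@pone i) (@pmul i).
Proof. by move=> u; apply: pval_inj => /=; rewrite (paste01 (psrc0 u)). Qed.

HB.instance Definition _ i :=
  isMonoid.Build (pcell i) (@pmulA i) (@pmul1 i) (@pmulr1 i).

Definition psrc i (u : pcell i.+1) : pcell i :=
  PCell (etrans (src0_src _) (psrc0 u)) (etrans (tgt0_src _) (ptgt0 u)).
Definition ptgt i (u : pcell i.+1) : pcell i :=
  PCell (etrans (src0_tgt _) (psrc0 u)) (etrans (tgt0_tgt _) (ptgt0 u)).
Definition punit i (u : pcell i) : pcell i.+1 :=
  PCell (etrans (src0_unit _) (psrc0 u)) (etrans (tgt0_unit _) (ptgt0 u)).

Fixpoint ipsrc j i (p : upto j i) : pcell i -> pcell j :=
  match p in upto _ i return pcell i -> pcell j with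
  | upto_refl => id
  | upto_S _ p => fun u => ipsrc p (psrc u)
  end.
Fixpoint iptgt j i (p : upto j i) : pcell i -> pcell j :=
  match p in upto _ i return pcell i -> pcell j with
  | upto_refl => id
  | upto_S _ p => fun u => iptgt p (ptgt u)
  end.
Fixpoint ipunit j i (p : upto j i) : pcell j -> pcell i :=
  match p in upto _ i return pcell j -> pcell i with
  | upto_refl => id
  | upto_S _ p => fun u => punit (ipunit p u)
  end.

Lemma pval_src j i (p : upto j i) (u : pcell i) : ipsrc p u = isrc (upto_shift p) u :> G _.
Proof. by elim: p u => //= k p IH u; rewrite IH. Qed.
Lemma pval_tgt j i (p : upto j i) (u : pcell i) : iptgt p u = itgt (upto_shift p) u :> G _.
Proof. by elim: p u => //= k p IH u; rewrite IH. Qed.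
Lemma pval_unit j i (p : upto j i) (u : pcell j) : ipunit p u = iid (upto_shift p) u :> G _.
Proof. by rewrite /iid; elim: p u => //= k p IH u; rewrite IH. Qed.

Lemma psrcM i : {morph @psrc i : u v / u * v}.
Proof. by move=> u v; apply: pval_inj; rewrite /= src_paste0. Qed.
Lemma ptgtM i : {morph @ptgt i : u v / u * v}.
Proof. by move=> u v; apply: pval_inj; rewrite /= tgt_paste0. Qed.
Lemma punitM i : {morph @punit i : u v / u * v}.
Proof. by move=> u v; apply: pval_inj; rewrite /= unit_paste0. Qed.
Lemma psrcK i : cancel (@punit i) (@psrc i).
Proof. by move=> u; apply: pval_inj; rewrite /= src_unit. Qed.
Lemma ptgtK i : cancel (@punit i) (@ptgt i).
Proof. by move=> u; apply: pval_inj; rewrite /= tgt_unit. Qed.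
Lemma punit1 i : @punit i 1 = 1.
Proof. exact: pval_inj. Qed.
Lemma psrc1 i : @psrc i 1 = 1.
Proof. by rewrite -punit1 psrcK. Qed.
Lemma ptgt1 i : @ptgt i 1 = 1.
Proof. by rewrite -punit1 ptgtK. Qed.

HB.instance Definition _ i := isUMagmaMorphism.Build _ _ (@psrc i) (conj (@psrc1 i) (@psrcM i)).
HB.instance Definition _ i := isUMagmaMorphism.Build _ _ (@ptgt i) (conj (@ptgt1 i) (@ptgtM i)).
HB.instance Definition _ i := isUMagmaMorphism.Build _ _ (@punit i) (conj (@punit1 i) (@punitM i)).

Lemma iptgtM j i (p : upto j i) : {morph iptgt p : u v / u * v}.
Proof. by elim: p => // k p IH u v /=; rewrite ptgtM IH. Qed.
Lemma ipunitM j i (p : upto j i) : {morph ipunit p : u v / u * v}.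
Proof. by elim: p => // k p IH u v /=; rewrite IH punitM. Qed.
Lemma ipsrc1 j i (p : upto j i) : ipsrc p 1 = 1.
Proof. by elim: p => //= k p IH; rewrite psrc1. Qed.
Lemma ipunit1 j i (p : upto j i) : ipunit p 1 = 1.
Proof. by elim: p => //= k p IH; rewrite IH punit1. Qed.

HB.instance Definition _ j i (p : upto j i) :=
  isUMagmaMorphism.Build _ _ (ipunit p) (conj (ipunit1 p) (@ipunitM _ _ p)).

Lemma ipsrcK j i (p : upto j i) : cancel (ipunit p) (ipsrc p).
Proof. by elim: p => //= k p IH u; rewrite psrcK IH. Qed.
Lemma iptgtK j i (p : upto j i) : cancel (ipunit p) (iptgt p).
Proof. by elim: p => //= k p IH u; rewrite ptgtK IH. Qed.

Lemma psrc_tgt i (u : pcell i.+2) : psrc (ptgt u) = psrc (psrc u).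
Proof. by apply: pval_inj; rewrite /= src_tgt. Qed.
Lemma ptgt_src i (u : pcell i.+2) : ptgt (ptgt u) = ptgt (psrc u).
Proof. by apply: pval_inj; rewrite /= tgt_src. Qed.

Lemma psrc_ipsrc j i (r : upto j i) (s : upto j.+1 i) (v : pcell i) :
  psrc (ipsrc s v) = ipsrc r v.
Proof. by apply: pval_inj; rewrite pval_src /= pval_src (src_isrc _ (upto_shift r)). Qed.
Lemma ptgt_iptgt j i (r : upto j i) (s : upto j.+1 i) (v : pcell i) :
  ptgt (iptgt s v) = iptgt r v.
Proof. by apply: pval_inj; rewrite pval_tgt /= pval_tgt (tgt_itgt _ (upto_shift r)). Qed.
Lemma ipunit_punit j i (r : upto j i) (s : upto j.+1 i) (u : pcell j) :
  ipunit s (punit u) = ipunit r u.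
Proof. by apply: pval_inj; rewrite !pval_unit /= (iid_unit _ (upto_shift r)). Qed.

Lemma pcomposable j i (p : upto j.+1 i) (r : upto j i) (u v : pcell i) :
  ipsrc r u = iptgt r v -> composable p u v.
Proof.
move=> e; rewrite /composable (upto_irrelevance (upto_S p) (upto_shift r)).
by rewrite -pval_src -pval_tgt e.
Qed.

(** With a the iterated unit of the common boundary of u and v, apply the exchange
    law to u = u 1 and v = a (a^-1 v).  Invertibility of a is a hypothesis because
    inverses in the monoids of based cells are themselves constructed, by induction on the
    dimension, from this formula. *)
Lemma paste_pcell_l j i (p : upto j.+1 i) (r : upto j i) (u v : pcell i) (b : pcell j) :
    ipsrc r u * b = 1 -> b * ipsrc r u = 1 -> ipsrc r u = iptgt r v ->
  paste p u v = pval (u * (ipunit r b * v)).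
Proof.
move=> ab ba e; set a := ipunit r (ipsrc r u); set b' := ipunit r b.
have ab' : a * b' = 1 by rewrite -ipunitM ab ipunit1.
have E : upto_S p = upto_shift r by exact: upto_irrelevance.
transitivity (paste p (pval (u * 1)) (pval (a * (b' * v)))).
  by rewrite mulg1 mulgA ab' mul1g.
have C1 : composable p u a by apply: (pcomposable p (r := r)); rewrite iptgtK.
have e2 : ipsrc r 1 = iptgt r (b' * v) by rewrite ipsrc1 iptgtM iptgtK -e ba.
have C2 := pcomposable p e2.
rewrite exchange0 // (paste_unit_r _ C1); last by rewrite E -pval_src -pval_unit.
by rewrite (paste_unit_l _ C2) // E -pval_tgt -pval_unit -e2 ipsrc1 ipunit1.
Qed.

(** The exchange law applied to u = 1 u and v = (v a^-1) a. *)
Lemma paste_pcell_r j i (p : upto j.+1 i) (r : upto j i) (u v : pcell i) (b : pcell j) :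
    ipsrc r u * b = 1 -> b * ipsrc r u = 1 -> ipsrc r u = iptgt r v ->
  paste p u v = pval (v * (ipunit r b * u)).
Proof.
move=> ab ba e; set a := ipunit r (ipsrc r u); set b' := ipunit r b.
have ba' : b' * a = 1 by rewrite -ipunitM ba ipunit1.
have E : upto_S p = upto_shift r by exact: upto_irrelevance.
transitivity (paste p (pval (1 * u)) (pval (v * b' * a))).
  by rewrite mul1g -mulgA ba' mulg1.
have C1 : composable p u a by apply: (pcomposable p (r := r)); rewrite iptgtK.
have e2 : ipsrc r 1 = iptgt r (v * b') by rewrite ipsrc1 iptgtM iptgtK -e ab.
have C2 := pcomposable p e2.
rewrite exchange0 // (paste_unit_r _ C1); last by rewrite E -pval_src -pval_unit.
rewrite (paste_unit_l _ C2); first by rewrite mulgA.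
by rewrite E -pval_tgt -pval_unit -e2 ipsrc1 ipunit1.
Qed.

(** A strict groupoid has inverses for the top composition only.  If u^- is the
    top inverse of u, then u (k s u)^-1 u^- = k t u, which by induction
    is invertible. *)
Lemma pinv_exists i (u : pcell i) : exists v, v * u = 1 /\ u * v = 1.
Proof.
suff R i0 (w : pcell i0) : exists v, w * v = 1.
  have [v uv] := R i u; have [w vw] := R i v; exists v; split=> //.
  by rewrite -{1}vw -[w]mul1g -uv -mulgA vw mulg1.
elim: i0 w => {i u}[|i IH] u.
  have [v [Huv [Hvu [e _]]]] := has_inverse (u : G 1%N).
  have sv : src0 v = x by rewrite -(ptgt0 u).
  have tv : tgt0 v = x by rewrite -(psrc0 u).
  exists (PCell sv tv); apply: pval_inj; rewrite /= /paste0 (pasteE Huv) e.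
  by rewrite [tgt u](ptgt0 u).
have [v [Huv [Hvu [e _]]]] := has_inverse (u : G i.+2).
have sv : src0 v = x by rewrite -src0_tgt -[tgt v]Huv src0_src psrc0.
have tv : tgt0 v = x by rewrite -tgt0_src [src v]Hvu tgt0_tgt ptgt0.
have [b' b'P] := IH (ptgt u).
have [b [ba ab]] : exists b, b * psrc u = 1 /\ psrc u * b = 1.
  have [b ab] := IH (psrc u); have [c bc] := IH b; exists b; split=> //.
  by rewrite -{1}bc -[c]mul1g -ab -mulgA bc mulg1.
exists (punit b * (PCell sv tv * punit b')).
have uv : u * (punit b * PCell sv tv) = punit (ptgt u).
  apply: pval_inj; rewrite -[punit b]/(ipunit (upto_S upto_refl) b).
  rewrite -(paste_pcell_l upto_refl) //; last by apply: pval_inj; exact: Huv.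
  by rewrite (pasteE (Huv : composable upto_refl u v)).
by rewrite !mulgA in uv *; rewrite uv -punitM b'P punit1.
Qed.

Definition pinv i (u : pcell i) : pcell i := projT1 (cid (pinv_exists u)).
Lemma pmulV i : left_inverse 1 (@pinv i) *%g.
Proof. by move=> u; rewrite /pinv; case: cid => v []. Qed.
Lemma pmulVr i : right_inverse 1 (@pinv i) *%g.
Proof. by move=> u; rewrite /pinv; case: cid => v []. Qed.

HB.instance Definition _ i := hasInv.Build (pcell i) (@pinv i).
HB.instance Definition _ i := Monoid_isGroup.Build (pcell i) (@pmulV i) (@pmulVr i).

Lemma paste_pcell j i (p : upto j.+1 i) (r : upto j i) (u v : pcell i) :
  ipsrc r u = iptgt r v -> paste p u v = pval (u * (ipunit r (ipsrc r u)^-1 * v)).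
Proof. by move=> e; apply: paste_pcell_l => //; [exact: mulgV | exact: mulVg]. Qed.

(** An Eckmann-Hilton argument: the two evaluations of the composite along a
    trivial j-cell are u v and v u. *)
Lemma pcell_commute j i (r : upto j i) (u v : pcell i) :
  ipsrc r u = 1 -> iptgt r v = 1 -> commute u v.
Proof.
move=> su tv; case: (upto_inv r) => [[e er]|].
  by subst i; move: su tv; rewrite er /= => -> ->.
case: i r u v su tv => [|i] r u v su tv [ji _] //.
have e : ipsrc r u = iptgt r v by rewrite su tv.
have p : upto j.+1 i.+1 by exact: leq_upto.
have := paste_pcell_r p (mulgV _) (mulVg _) e.
by rewrite (paste_pcell p e) su invg1 ipunit1 !mul1g => /pval_inj.
Qed.

End PointedCells.

(** * Integer powers *)

Section IntegerPowers.
Local Open Scope group_scope.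

Definition zexpg (T : groupType) (g : T) (z : int) : T :=
  match z with Posz n => g ^+ n | Negz n => (g ^+ n.+1)^-1 end.

Section Theory.
Variable T : groupType.
Implicit Type g : T.

Lemma commute_zexpg g h z : commute g h -> commute g (zexpg h z).
Proof. by move=> c; case: z => n; rewrite /zexpg; [|apply: commuteV]; exact: commuteX. Qed.

Lemma zexpgS g (z : int) : zexpg g (1 + z)%R = g * zexpg g z.
Proof.
case: z => n; first by rewrite -PoszD /= expgS.
case: n => [|n]; first by rewrite /= mulgV.
have -> : (1 + Negz n.+1)%R = Negz n by lia.
by rewrite /zexpg [in RHS]expgSr invgM mulgA mulgV mul1g.
Qed.

Lemma zexpgD g (y z : int) : zexpg g (y + z)%R = zexpg g y * zexpg g z.
Proof.
elim/int_ind: y => [|n IH|n IH]; first by rewrite GRing.add0r mul1g.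
- have -> : (n.+1%:Z + z)%R = (1 + (n%:Z + z))%R by lia.
  by rewrite zexpgS IH intS zexpgS mulgA.
- apply: (mulgI g); rewrite mulgA -!zexpgS.
  have -> : (1 + (- n.+1%:Z + z))%R = (- n%:Z + z)%R by lia.
  by have -> : (1 + (- n.+1%:Z))%R = (- n%:Z)%R by lia.
Qed.

Lemma zexpg1n (z : int) : zexpg 1 z = 1 :> T.
Proof. by case: z => n; rewrite /zexpg expg1n ?invg1. Qed.

End Theory.

Lemma gmulf_zexpg (S T : groupType) (f : UMagmaMorphism.type S T) g z :
  f (zexpg g z) = zexpg (f g) z.
Proof. by case: z => n; rewrite /zexpg ?gmulfV gmulfXn. Qed.

End IntegerPowers.

(** * Commuting products of displacements *)

Section Tower.
Variables (G : strict_groupoid) (x : G 0).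
Variable eps : forall i, pcell x i.
Local Open Scope group_scope.
Hypothesis eps0 : eps 0 = 1.
Hypothesis psrc_eps : forall i, psrc (eps i.+1) = eps i.

Definition disp i : pcell x i.+1 := (punit (eps i))^-1 * eps i.+1.
Definition gap i : pcell x i := ptgt (disp i).

Lemma psrc_disp i : psrc (disp i) = 1.
Proof. by rewrite psrcM psrc_eps gmulfV /= psrcK mulVg. Qed.

Lemma psrc_gap i : psrc (gap i.+1) = 1.
Proof. by rewrite psrc_tgt psrc_disp psrc1. Qed.

Lemma ptgt_gap i : ptgt (gap i.+1) = 1.
Proof. by rewrite ptgt_src psrc_disp ptgt1. Qed.

(** The factor K_m contributes powers of c = gap (m-1) and w = disp (m-1), in
    accordance with the shift of the index of [pcell]: the m-cell z is sent to
    c ^ z, and the (m+1)-cell from y to z to c ^ y w ^ (z - y), whose target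
    is c ^ z since the target of w is c. *)
Fixpoint prod_cell i (c : coord) : pcell x i :=
  match i with
  | 0 => zexpg (gap 0) (c 1%N).1
  | i.+1 => punit (prod_cell i c) * zexpg (disp i) ((c i.+1).2 - (c i.+1).1)%R
              * zexpg (gap i.+1) (c i.+2).1
  end.

Lemma prod_cell_ext i (c d : coord) :
  (forall m, 0 < m <= i -> c m = d m) -> (c i.+1).1 = (d i.+1).1 ->
  prod_cell i c = prod_cell i d.
Proof.
elim: i => [|i IH] cd e /=; first by rewrite e.
rewrite e cd ?leqnn // IH ?cd ?leqnn // => m /andP[m0 mi].
by apply: cd; rewrite m0 leqW.
Qed.

Lemma psrc_prod i c : psrc (prod_cell i.+1 c) = prod_cell i c.
Proof.
rewrite /= !psrcM psrcK !gmulf_zexpg /= psrc_disp psrc_gap.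
by rewrite !zexpg1n !mulg1.
Qed.

Lemma ptgt_prod i (c d : coord) :
  (forall m, 0 < m <= i -> c m = d m) -> (c i.+1).2 = (d i.+1).1 ->
  ptgt (prod_cell i.+1 c) = prod_cell i d.
Proof.
move=> cd e; rewrite [prod_cell i.+1 c]/= !ptgtM ptgtK !gmulf_zexpg /= ptgt_gap.
rewrite zexpg1n mulg1 e -/(gap i).
have D y : zexpg (gap i) y * zexpg (gap i) ((d i.+1).1 - y) = zexpg (gap i) (d i.+1).1.
  by rewrite -zexpgD GRing.addrC GRing.subrK.
case: i cd e D => [|i] cd e D /=; rewrite -?mulgA D //.
rewrite cd ?leqnn // (@prod_cell_ext i c d) ?cd ?leqnn // => m /andP[m0 mi].
by apply: cd; rewrite m0 leqW.
Qed.

Lemma punit_prod i (c : coord) : (c i.+1).1 = (c i.+1).2 -> (c i.+2).1 = 0%R ->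
  prod_cell i.+1 c = punit (prod_cell i c).
Proof. by move=> /= -> ->; rewrite GRing.subrr /= !mulg1. Qed.

(** A displacement has trivial source, hence so do its iterated units, at the
    same level. *)
Lemma commute_disp j i (r : upto j i) (s : upto j.+1 i) (v : pcell x i) :
  iptgt r v = 1 -> commute v (ipunit s (disp j)).
Proof.
move=> tv; apply/commute_sym/(pcell_commute (r := r)) => //.
by rewrite -(psrc_ipsrc _ s) ipsrcK psrc_disp.
Qed.

Lemma ptgt_gapdisp i : ptgt (punit (gap i) * (disp i)^-1) = 1.
Proof. by rewrite ptgtM ptgtK gmulfV mulgV. Qed.

(** The unit on c = gap j is (k c w^-1) w with w = disp j: its first factor has
    trivial target and its second one trivial source. *)
Lemma commute_gap j i (r : upto j i) (v : pcell x i) :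
  ipsrc r v = 1 -> iptgt r v = 1 -> commute v (ipunit r (gap j)).
Proof.
move=> sv tv; case: (upto_inv r) => [[e er]|[lt _]].
  by subst i; move: sv; rewrite er /= => ->; exact/commute_sym/commute1.
pose s := leq_upto lt; rewrite -(ipunit_punit _ s).
rewrite -[punit _](divgK (disp j) (punit _)) ipunitM; apply: commuteM.
  by apply: (pcell_commute (r := r)) => //; rewrite -(ptgt_iptgt _ s) iptgtK ptgt_gapdisp.
exact: commute_disp tv.
Qed.

Lemma commute_disp_gap i : commute (disp i) (punit (gap i)).
Proof.
rewrite -[punit _](divgK (disp i) (punit _)); apply: commuteM; last exact: commute_refl.
by apply: (pcell_commute (r := upto_S upto_refl)); [exact: psrc_disp | exact: ptgt_gapdisp].
Qed.

Lemma commute_prod_cell j i (r : upto j i) (v : pcell x i) c :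
  ipsrc r v = 1 -> iptgt r v = 1 -> commute v (ipunit r (prod_cell j c)).
Proof.
elim: j r => [|j IH] r sv tv.
  by rewrite /= gmulf_zexpg; apply/commute_zexpg/commute_gap.
(* The boundary of v is trivial one level lower as well. *)
pose r' := leq_upto (ltnW (upto_leq r)).
have sv' : ipsrc r' v = 1 by rewrite -(psrc_ipsrc _ r) sv psrc1.
have tv' : iptgt r' v = 1 by rewrite -(ptgt_iptgt _ r) tv ptgt1.
rewrite /= !ipunitM !gmulf_zexpg (ipunit_punit r').
apply: commuteM; last exact/commute_zexpg/commute_gap.
apply: commuteM; first exact: IH.
exact/commute_zexpg/(commute_disp (r := r')).
Qed.

(** The target of [disp i] is not trivial, but its boundaries below are, so only
    the last factor of the product escapes [commute_prod_cell]. *)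
Lemma commute_disp_prod i c : commute (disp i) (punit (prod_cell i c)).
Proof.
case: i => [|i]; rewrite /= ?punitM !gmulf_zexpg.
  exact/commute_zexpg/commute_disp_gap.
have sv : psrc (psrc (disp i.+1)) = 1 by rewrite psrc_disp psrc1.
have tv : ptgt (ptgt (disp i.+1)) = 1 by rewrite -/(gap i.+1) ptgt_gap.
apply: commuteM; last exact/commute_zexpg/commute_disp_gap.
apply: commuteM; first exact: (commute_prod_cell (r := upto_S (upto_S upto_refl))).
by apply/commute_zexpg/(commute_disp (r := upto_S (upto_S upto_refl)) (upto_S upto_refl)).
Qed.

Lemma prod_cellD i (c d e : coord) :
  (forall m, (e m).1 = (c m).1 + (d m).1 /\ (e m).2 = (c m).2 + (d m).2)%R ->
  prod_cell i e = prod_cell i c * prod_cell i d.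
Proof.
move=> ecd; elim: i => [|i IH] /=; first by have [-> _] := ecd 1%N; rewrite zexpgD.
have [e1 e2] := ecd i.+1; have [e3 _] := ecd i.+2.
have -> : ((e i.+1).2 - (e i.+1).1 =
  ((c i.+1).2 - (c i.+1).1) + ((d i.+1).2 - (d i.+1).1))%R by lia.
move: (_ - _)%R (_ - _)%R => y z.
rewrite e3 IH punitM !zexpgD -!mulgA; congr (_ * _).
set A := zexpg _ _; set A' := zexpg _ _; set B := zexpg _ _; set B' := zexpg _ _.
set k := punit _.
have Ak : commute A k by apply/commute_sym/commute_zexpg/commute_sym/commute_disp_prod.
have gk : commute (gap i.+1) k.
  by apply: (commute_prod_cell (r := upto_S upto_refl)); [exact: psrc_gap | exact: ptgt_gap].
have gA : commute (gap i.+1) (disp i).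
  by apply: (commute_disp (r := upto_S upto_refl) upto_refl); exact: ptgt_gap.
have Bk : commute B k by exact/commute_sym/commute_zexpg/commute_sym.
have BA : commute B A'.
  by apply/commute_sym/commute_zexpg/commute_sym/commute_zexpg.
rewrite (mulgA k A) -Ak -!mulgA; congr (_ * _).
by rewrite (mulgA B k) Bk -!mulgA (mulgA B A') BA !mulgA.
Qed.

(** With all exponents of the displacements equal to 1 the product telescopes. *)
Lemma prod_cell_eps i (c : coord) :
  (forall m, 0 < m <= i -> c m = (0, 1)%R) -> (c i.+1).1 = 0%R ->
  prod_cell i c = eps i.
Proof.
elim: i => [|i IH] cm ci /=; first by rewrite ci eps0.
rewrite ci mulg1 IH ?cm ?leqnn ?GRing.subr0 ?mulVKg // => m /andP[m0 mi].
by apply: cm; rewrite m0 leqW.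
Qed.

End Tower.

(** * Conjugation by arrows *)

Section ArrowUnits.
Variable G : strict_category.

Definition unit1 i (a : G 1) : G i.+1 := iid (upto_shift (upto0 i)) a.

Lemma unit1S i (a : G 1) : unit1 i.+1 a = unit_cell (unit1 i a). Proof. by []. Qed.

Lemma src0_unit1 i (a : G 1) : src0 (unit1 i a) = src a.
Proof. by elim: i => // i IH; rewrite unit1S src0_unit. Qed.
Lemma tgt0_unit1 i (a : G 1) : tgt0 (unit1 i a) = tgt a.
Proof. by elim: i => // i IH; rewrite unit1S tgt0_unit. Qed.

Lemma unit1_unit i (z : G 0) : unit1 i (unit_cell z) = unit0 i.+1 z.
Proof. by elim: i => // i IH; rewrite unit1S IH. Qed.

Lemma unit1_paste0 i (a b : G 1) : src a = tgt b ->
  unit1 i (paste0 a b) = paste0 (unit1 i a) (unit1 i b).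
Proof.
move=> E; elim: i => // i IH; rewrite !unit1S IH unit_paste0 //.
by rewrite src0_unit1 tgt0_unit1.
Qed.

Lemma isrc_unit1 j i (p : upto j.+1 i.+1) (a : G 1) : isrc p (unit1 i a) = unit1 j a.
Proof. by have [r ->] := upto_shiftP p; elim: r => //= k r IH; rewrite src_unit IH. Qed.
Lemma itgt_unit1 j i (p : upto j.+1 i.+1) (a : G 1) : itgt p (unit1 i a) = unit1 j a.
Proof. by have [r ->] := upto_shiftP p; elim: r => //= k r IH; rewrite tgt_unit IH. Qed.
Lemma iid_unit1 j i (p : upto j.+1 i.+1) (a : G 1) : iid p (unit1 j a) = unit1 i a.
Proof. by have [r ->] := upto_shiftP p; rewrite /iid; elim: r => //= k r ->. Qed.

Lemma unit1_composable j i (p : upto j.+1 i) (a : G 1) :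
  composable p (unit1 i a) (unit1 i a).
Proof. by rewrite /composable isrc_unit1 itgt_unit1. Qed.

Lemma paste_unit1 j i (p : upto j.+1 i) (a : G 1) :
  paste p (unit1 i a) (unit1 i a) = unit1 i a.
Proof.
by apply: paste_unit_l (unit1_composable _ _); rewrite itgt_unit1 iid_unit1.
Qed.

End ArrowUnits.

Lemma unit_is_inverse (G : strict_category) i (z : G i) :
  is_inverse (unit_cell z) (unit_cell z).
Proof.
have E : composable upto_refl (unit_cell z) (unit_cell z).
  by rewrite /composable /= src_unit tgt_unit.
by exists E, E; rewrite src_unit tgt_unit -(pasteE E) (paste_unit_l _ E) //= tgt_unit.
Qed.

Section Conjugation.
Variables (G : strict_groupoid) (x : G 0).
Variables (I : Type) (h h' : I -> G 1).
Hypothesis src_h : forall z, src (h z) = x.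
Hypothesis h_inv : forall z, is_inverse (h z) (h' z).

Let src_h' z : src (h' z) = tgt (h z).
Proof. by have [_ [+ _]] := h_inv z. Qed.
Let tgt_h' z : tgt (h' z) = x.
Proof. by rewrite -(src_h z); have [+ _] := h_inv z. Qed.

Definition pconj i (z z' : I) (u : pcell x i) : G i.+1 :=
  paste0 (unit1 i (h z')) (paste0 u (unit1 i (h' z))).

Let cu i z (u : pcell x i) : src0 u = tgt0 (unit1 i (h' z)).
Proof. by rewrite psrc0 tgt0_unit1 tgt_h'. Qed.
Let cl i z (u : pcell x i) : src0 (unit1 i (h z)) = tgt0 u.
Proof. by rewrite ptgt0 src0_unit1 src_h. Qed.
Let ch i z z' (u : pcell x i) : src0 (unit1 i (h z')) = tgt0 (paste0 u (unit1 i (h' z))).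
Proof. by rewrite tgt0_paste0 // cl. Qed.

Lemma src0_conj i z z' (u : pcell x i) : src0 (pconj z z' u) = tgt (h z).
Proof. by rewrite src0_paste0 // src0_paste0 // src0_unit1. Qed.
Lemma tgt0_conj i z z' (u : pcell x i) : tgt0 (pconj z z' u) = tgt (h z').
Proof. by rewrite tgt0_paste0 // tgt0_unit1. Qed.

Lemma src_conj i z z' (u : pcell x i.+1) : src (pconj z z' u) = pconj z z' (psrc u).
Proof. by rewrite src_paste0 // src_paste0 // !unit1S !src_unit. Qed.
Lemma tgt_conj i z z' (u : pcell x i.+1) : tgt (pconj z z' u) = pconj z z' (ptgt u).
Proof. by rewrite tgt_paste0 // tgt_paste0 // !unit1S !tgt_unit. Qed.
Lemma unit_conj i z z' (u : pcell x i) : unit_cell (pconj z z' u) = pconj z z' (punit u).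
Proof. by rewrite unit_paste0 // unit_paste0. Qed.

Lemma paste0_h i z : paste0 (unit1 i (h z)) (unit1 i (h' z)) = unit0 i.+1 (tgt (h z)).
Proof.
have [E [_ [e _]]] := h_inv z.
by rewrite -unit1_paste0 // /paste0 (pasteE (E : composable (upto0 0) _ _)) [comp _ _]e unit1_unit.
Qed.
Lemma paste0_h' i z : paste0 (unit1 i (h' z)) (unit1 i (h z)) = unit0 i.+1 x.
Proof.
have [_ [E [_ e]]] := h_inv z; rewrite -unit1_paste0 // /paste0.
by rewrite (pasteE (E : composable (upto0 0) _ _)) [comp _ _]e unit1_unit src_h.
Qed.

Lemma conj1 i z : pconj z z (1%g : pcell x i) = unit0 i.+1 (tgt (h z)).
Proof. by rewrite /pconj (paste10 (z := x)) ?paste0_h // tgt0_unit1. Qed.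

Lemma conjM i z z' z'' (u v : pcell x i) :
  paste0 (pconj z' z'' u) (pconj z z' v) = pconj z z'' (u * v)%g.
Proof.
rewrite {1}/pconj paste0A ?src0_paste0 ?src0_unit1 ?tgt0_conj //.
congr paste0; rewrite paste0A ?tgt0_conj ?src0_unit1 //.
rewrite /pconj -(paste0A (u := unit1 i (h' z'))) ?src0_unit1 ?tgt0_unit1 //.
rewrite paste0_h' paste10 ?tgt0_paste0 ?ptgt0 //.
all: by rewrite -?paste0A ?src_h ?tgt0_paste0 ?ptgt0 ?psrc0 ?tgt0_unit1 ?tgt_h'.
Qed.

(** By the exchange law, since units are idempotent for higher compositions. *)
Lemma conj_paste j i (p : upto j.+1 i) z z' (u v w : pcell x i) :
    composable p u v -> paste p u v = w ->
  paste p (pconj z z' u) (pconj z z' v) = pconj z z' w.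
Proof.
move=> E e.
have c1 a := unit1_composable p a.
have c2 : composable p (paste0 u (unit1 i (h' z))) (paste0 v (unit1 i (h' z))).
  by rewrite /composable isrc_paste0 // itgt_paste0 // isrc_unit1 itgt_unit1 E.
by rewrite /pconj exchange0 // paste_unit1 exchange0 // paste_unit1 e.
Qed.

End Conjugation.

(** * Every cell is the image of a cell of the coordinate groupoid *)

Section Realization.
Variables (G : strict_groupoid) (eps : forall i, G i).
Hypothesis src_eps : forall i, src (eps i.+1) = eps i.
Let x := eps 0.

Let finv : G 1 := projT1 (cid (has_inverse (eps 1))).
Let finvP : is_inverse (eps 1) finv. Proof. exact: projT2 (cid (has_inverse (eps 1))). Qed.

(** The arrow of G that joins x to the image of the object z, and its inverse. *)
Definition path_to (z : int) : G 1 := if z == 0%R then unit_cell x else eps 1.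
Definition path_from (z : int) : G 1 := if z == 0%R then unit_cell x else finv.

Lemma src_path_to z : src (path_to z) = x.
Proof. by rewrite /path_to; case: eqP; rewrite ?src_unit ?src_eps. Qed.
Lemma path_inv z : is_inverse (path_to z) (path_from z).
Proof. by rewrite /path_to /path_from; case: eqP => _; [exact: unit_is_inverse|]. Qed.

Let src0_eps i : src0 (eps i) = x.
Proof. by elim: i => // i IH; rewrite -src0_src src_eps. Qed.
Let tgt0_eps i : tgt0 (eps i.+1) = tgt (eps 1).
Proof. by elim: i => // i IH; rewrite -tgt0_src src_eps. Qed.

Let loop_epsP i : src0 (unit1 i finv) = tgt0 (eps i.+1).
Proof. by rewrite src0_unit1 tgt0_eps; have [_ [+ _]] := finvP. Qed.

Let tgt_finv : tgt finv = x.
Proof. by have [E _] := finvP; exact: etrans (esym E) (src_eps 0). Qed.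

Definition loop_eps i : pcell x i.
Proof.
apply: (@PCell _ _ _ (paste0 (unit1 i finv) (eps i.+1))).
- by rewrite src0_paste0 // src0_eps.
- by rewrite tgt0_paste0 // tgt0_unit1.
Defined.

Lemma loop_eps0 : loop_eps 0 = 1%g.
Proof.
apply: pval_inj => /=; have [_ [E [_ e]]] := finvP.
by rewrite /paste0 (pasteE (E : composable (upto0 0) _ _)) [comp _ _]e src_eps.
Qed.

Lemma psrc_loop_eps i : psrc (loop_eps i.+1) = loop_eps i.
Proof. by apply: pval_inj; rewrite /= src_paste0 // src_eps src_unit. Qed.

Let P i (c : coord) : pcell x i := prod_cell loop_eps i c.

Lemma psrc_P i (u : coord_glob i.+2) : psrc (P i.+1 u) = P i (src u : ccell _).
Proof.
rewrite /P (psrc_prod psrc_loop_eps).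
apply: prod_cell_ext => [m /andP[_ mi]|]; rewrite /= /trunc.
  by rewrite ltnS mi.
by rewrite ltnn eqxx.
Qed.

Lemma ptgt_P i (u : coord_glob i.+2) : ptgt (P i.+1 u) = P i (tgt u : ccell _).
Proof.
rewrite /P; apply: (ptgt_prod psrc_loop_eps) => [m /andP[_ mi]|]; rewrite /= /trunc.
  by rewrite ltnS mi.
by rewrite ltnn eqxx.
Qed.

Lemma punit_P i (u : coord_glob i.+1) : punit (P i u) = P i.+1 (cunit u).
Proof.
by rewrite /P punit_prod //; [exact: (cval_ge u (leqnn _)) | exact: (cval_gt u (leqnn _))].
Qed.

Lemma ipsrc_P j i (r : upto j i) (u : coord_glob i.+1) :
  ipsrc r (P i u) = P j (isrc (upto_shift r) u : ccell _).
Proof. by elim: r u => //= k r IH u; rewrite psrc_P IH. Qed.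
Lemma iptgt_P j i (r : upto j i) (u : coord_glob i.+1) :
  iptgt r (P i u) = P j (itgt (upto_shift r) u : ccell _).
Proof. by elim: r u => //= k r IH u; rewrite ptgt_P IH. Qed.
Lemma ipunit_P j i (r : upto j i) (u : coord_glob j.+1) :
  ipunit r (P j u) = P i (iunit cunit (upto_shift r) u : ccell _).
Proof. by elim: r => // k r IH; rewrite [ipunit _ _]/= IH punit_P. Qed.

Lemma P_add i (c d e : coord) :
  (forall m, (0 < m)%N -> (e m).1 = (c m).1 + (d m).1 /\ (e m).2 = (c m).2 + (d m).2)%R ->
  P i e = (P i c * P i d)%g.
Proof.
move=> ecd; rewrite -(@prod_cellD _ _ _ psrc_loop_eps i c d (addc c d)) //.
have ea m : 0 < m -> e m = addc c d m.
  by move=> m0; have [e1 e2] := ecd m m0; apply: pair_ext.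
by apply: prod_cell_ext => [m /andP[m0 _]|]; rewrite ea.
Qed.

Lemma P_commute i c d : commute (P i c) (P i d).
Proof.
rewrite /commute -(@P_add i c d (addc c d)) // -(@P_add i d c (addc c d)) // => m _.
by split; rewrite /= GRing.addrC.
Qed.

(** If a is the common boundary of u and v, then the coordinates satisfy
    u *_j v + a = u + v, so P sends u *_j v to P u (P a)^-1 P v, which is the
    composite of P u and P v. *)
Lemma paste_P j i (p : upto j.+1 i) (u v : coord_glob i.+1) (E : composable p u v) :
  composable p (P i u) (P i v) /\ paste p (P i u) (P i v) = P i (ccomp E : ccell _).
Proof.
have [r er] := upto_shiftP (upto_S p).
have e : ipsrc r (P i u) = iptgt r (P i v).
  by rewrite ipsrc_P iptgt_P -er; congr P; rewrite (E : isrc (upto_S p) u = _).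
split; first exact: pcomposable e.
rewrite (paste_pcell p e); congr pval; rewrite ipsrc_P -er.
set a := isrc _ u.
have -> : ipunit r (P j (a : ccell _))^-1%g = ((P i (a : ccell _))^-1)%g.
  rewrite gmulfV; congr (_^-1)%g; rewrite [LHS]ipunit_P; congr (P i _).
  by apply/funext => m; exact: iunitE.
apply: (mulIg (P i (a : ccell _))); rewrite -!mulgA.
rewrite -(@P_add i (ccomp E : ccell _) (a : ccell _) (addc (ccomp E : ccell _) (a : ccell _))) //.
have -> : (P i v * P i (a : ccell _) = P i (a : ccell _) * P i v)%g by exact: P_commute.
rewrite mulKg; apply/esym; apply: P_add => m m0.
have [E1 E2] := ccomposable E.
rewrite /addc [a m](isrcE (upto_S p)) /= /pastec /trunc.
by case: (ltngtP m j.+1) => mj /=; split;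
  rewrite ?(E1 m mj) ?mj ?GRing.addr0 //; rewrite -?E2; lia.
Qed.

Definition realize_cell i : coord_glob i -> G i :=
  match i return coord_glob i -> G i with
  | 0 => fun u => tgt (path_to ((u : ccell 0) 0).1)
  | i.+1 => fun u =>
      pconj path_to path_from ((u : ccell _) 0).1 ((u : ccell _) 0).2 (P i (u : ccell _))
  end.

Definition realize_map : globular_map coord_groupoid G.
Proof.
apply: (@GlobularMap coord_groupoid G realize_cell) => -[|i] u.
- exact: esym (src0_conj src_path_to path_inv
    ((u : ccell 1) 0).1 ((u : ccell 1) 0).2 (P 0 (u : ccell 1))).
- by rewrite [RHS](src_conj src_path_to path_inv) psrc_P.
- exact: esym (tgt0_conj src_path_to path_inv
    ((u : ccell 1) 0).1 ((u : ccell 1) 0).2 (P 0 (u : ccell 1))).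
- by rewrite [RHS](tgt_conj src_path_to path_inv) ptgt_P.
Defined.

Definition realize : strict_functor coord_groupoid G.
Proof.
apply: (@StrictFunctor coord_groupoid G realize_map).
  case=> [|i] u.
    rewrite /= -(cval_ge u (leqnn 0)) (cval_gt u (ltnSn 0)).
    exact: (conj1 src_path_to path_inv).
  by rewrite [RHS](unit_conj src_path_to path_inv) punit_P.
move=> [|j] i p u v E E'; rewrite -(pasteE E') /=.
  have [_ e0] := ccomposable E.
  rewrite e0 (upto_irrelevance p (upto0 i)) -/(paste0 _ _) (conjM src_path_to path_inv).
  by congr pconj; apply: P_add => m m0; rewrite /= /pastec leqNgt m0.
have [PE Pe] := paste_P E; have [e _] := ccomposable E.
by rewrite e // (conj_paste src_path_to path_inv _ _ PE Pe).
Defined.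

Lemma realize_disk n : fmap realize n (disk_coord n) = eps n.
Proof.
case: n => [|n] /=; first by rewrite /path_to eqxx tgt_unit.
rewrite (_ : P _ _ = loop_eps n); last first.
  apply: (prod_cell_eps loop_eps0) => // m /andP[_ mn].
  by rewrite /disk_coord_raw ltnS mn.
rewrite /pconj /path_to /path_from /=.
rewrite unit1_unit paste01; last by rewrite src0_paste0 // src0_eps.
rewrite -paste0A //; last by rewrite src0_unit1 tgt0_unit1 src_eps tgt_finv.
have [E [_ [e _]]] := finvP; have f1 : paste0 (eps 1) finv = unit_cell (tgt (eps 1)).
  by rewrite /paste0 (pasteE (E : composable (upto0 0) _ _)) [comp _ _]e.
by rewrite -unit1_paste0 // f1 unit1_unit paste10 ?tgt0_eps.
Qed.

End Realization.

Lemma cell_through_coord (G : strict_groupoid) n (e : G n) :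
  exists f : strict_functor coord_groupoid G, fmap f n (disk_coord n) = e.
Proof.
have [eps [src_eps <-]] := source_tower e.
by exists (realize src_eps); exact: realize_disk.
Qed.

(** * Maps out of a disk *)

Section Yoneda.
Variables (X : globular_set) (n : nat) (c : X n).

Fixpoint word_cell i (w : gword n i) : X i :=
  match w in gword _ i return X i with
  | gnil => c
  | gpre e _ w => bd e (word_cell w)
  end.

Lemma word_cell_eq i (w w' : gword n i) : gword_eq w w' -> word_cell w = word_cell w'.
Proof.
elim=> //= {i w w'} [i w1 w2 w3 _ -> _ -> //|e i w w' _ -> //|[] i w].
- exact: tgt_src.
- exact: src_tgt.
Qed.

Definition hom_cell i (d : disk n i) : X i := word_cell (repr d : gword n i).

Lemma hom_cell_class i (w : gword n i) : hom_cell (gclass w) = word_cell w.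
Proof. by apply/word_cell_eq/gclassP; rewrite [LHS]reprK. Qed.

Definition disk_map : globular_map (disk n) X.
Proof.
by apply: (@GlobularMap (disk n) X hom_cell) => i d; rewrite [LHS]hom_cell_class.
Defined.

Lemma disk_mapE : disk_map n (gclass (gnil n)) = c.
Proof. exact: hom_cell_class. Qed.

Lemma disk_map_uniq (g : globular_map (disk n) X) : g n (gclass (gnil n)) = c ->
  forall i d, g i d = disk_map i d.
Proof.
move=> gc i d; have [w ->] := gclass_surj d; rewrite [RHS]hom_cell_class.
elim: w {d} => //= e {}i w IH; rewrite -globe_pre_class -IH.
by case: e; [exact: gmap_tgt | exact: gmap_src].
Qed.

End Yoneda.

(** * Weak contractibility *)

Definition functor_id (G : strict_category) : strict_functor G G.
Proof.
apply: (@StrictFunctor G G (@GlobularMap G G (fun=> id) (fun _ _ => erefl) (fun _ _ => erefl))) => //.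
by move=> j i p u v E E'; apply: comp_congr.
Defined.

Definition globular_map_comp (X Y Z : globular_set) (g : globular_map Y Z) (f : globular_map X Y) :
  globular_map X Z.
Proof.
by apply: (@GlobularMap X Z (fun i u => g i (f i u))) => i u; rewrite ?gmap_src ?gmap_tgt.
Defined.

Definition functor_comp (G H K : strict_category) (g : strict_functor H K)
  (f : strict_functor G H) : strict_functor G K.
Proof.
apply: (@StrictFunctor G K (globular_map_comp (fmap g) (fmap f))).
  by move=> i u; rewrite /= !fmap_unit.
move=> j i p u v E E' /=.
by rewrite (fmap_comp E (gmap_composable (fmap f) E)) fmap_comp.
Defined.

Lemma weakly_contractible_of_parallel (G : strict_groupoid) (x : G 0) :
    (forall u v : G 0, homotopic u v) ->
    (forall i (u v : G i.+1), src u = src v -> tgt u = tgt v -> homotopic u v) ->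
  weakly_contractible G.
Proof.
move=> conn0 conn; split=> [|m y a].
  exists (\pi_({eq_quot (@object_eqb G)})%qT (x : {classic (G 0)})) => d.
  by rewrite -[d]reprK; apply/eqmodP/asboolP/conn0.
by rewrite -(pi_reprK a); apply/pi_classP/conn; rewrite ?loop_src ?loop_tgt.
Qed.

Lemma weakly_contractible_retract (G H : strict_groupoid) (s : strict_functor G H)
    (q : strict_functor H G) :
    (forall i (u : G i), fmap q i (fmap s i u) = u) ->
    (forall u v : H 0, homotopic u v) ->
    (forall i (u v : H i.+1), src u = src v -> tgt u = tgt v -> homotopic u v) ->
    H 0 -> weakly_contractible G.
Proof.
move=> qs conn0 conn x.
have lift i (u v : G i) : homotopic (fmap s i u) (fmap s i v) -> homotopic u v.
  move=> [a [sa ta]]; exists (fmap q i.+1 a).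
  by rewrite -gmap_src -gmap_tgt sa ta !qs.
apply: (weakly_contractible_of_parallel (fmap q 0 x)) => [u v|i u v suv tuv].
  exact/lift/conn0.
by apply/lift/conn; rewrite -?gmap_src -?gmap_tgt ?suv ?tuv.
Qed.

Theorem theorem5p6 (L : left_adjoint) (n : nat) : weakly_contractible (L (disk n)).
Proof.
pose D := disk n; pose eta := ladj_unit L D.
have [q qe] := cell_through_coord (eta n (gclass (gnil n))).
pose g := disk_map (disk_coord n).
have [s [sg _]] := @ladj_universal L D coord_groupoid g.
have [f [_ fU]] := @ladj_universal L D (L D) eta.
have qs i (u : L D i) : fmap q i (fmap s i u) = u.
  rewrite -[LHS]/(fmap (functor_comp q s) i u) fU => [|j d].
    by rewrite -(fU (functor_id (L D))).
  rewrite /= (sg j d) (disk_map_uniq (g := eta) erefl) -[LHS]/(globular_map_comp (fmap q) g j d).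
  by apply: disk_map_uniq; rewrite -qe; congr (fmap q n _); exact: disk_mapE.
apply: (weakly_contractible_retract qs _ (@coord_parallel)); last exact: disk_coord 0.
by move=> u v; apply: coord_homotopic.
Qed.
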